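(* There are constants $c_0$ and $a>0$ such that the following hold, where $\mathcal A'$ denotes the bipartition output by the algorithm Swap on $G=G_{n,p}$. (a) If $p=p(n)$ satisfies $c_0\le np\le n-c_0$ for all sufficiently large $n$, then whp $q_{\mathcal A'}(G_{n,p})\ge\frac15\sqrt{\frac{1-p}{np}}$. (b) If $p=p(n)$ satisfies $1\le np\le n-c_0$ for all sufficiently large $n$, then whp $q_{\mathcal A'}(G_{n,p})\ge a\sqrt{\frac{1-p}{np}}$.
   Context: For a graph $G$ with $m\ge 1$ edges and a vertex partition $\mathcal A$, $q_{\mathcal A}(G)=\frac1m\sum_{A\in\mathcal A}e(A)-\frac{1}{4m^2}\sum_{A\in\mathcal A}\mathrm{vol}(A)^2$ ($e(A)$: number of edges within $A$; $\mathrm{vol}(A)$: sum of degrees in $A$). Algorithm Swap: given a graph $G$ on $V=[n]$, $n\ge 6$, let $k=\lfloor n/6\rfloor$, $V_0=[4k]$, $V_1=\{4k+1,\dots,6k\}$, $V_2=\{6k+1,\dots,n\}$. Let $A$ be the odd elements and $B$ the even elements of $V$, and $A_j=A\cap V_j$, $B_j=B\cap V_j$ for $j=0,1,2$. For $i\in[2k]$ let $a_i=2i-1$, $b_i=2i$, and $T_i=e(a_i,B_1)-e(a_i,A_1)+e(b_i,A_1)-e(b_i,B_1)$, where $e(v,S)$ is the number of neighbours of $v$ in $S$. Set $(a_i',b_i')=(b_i,a_i)$ if $T_i>0$ and $(a_i',b_i')=(a_i,b_i)$ otherwise; let $A_0'=\{a_i'\}$, $B_0'=\{b_i'\}$. The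 output is the bipartition $\mathcal A'$ with parts $A_0'\cup A_1\cup A_2$ and $B_0'\cup B_1\cup B_2$. $G_{n,p}$ is the Erdős–Rényi random graph on $[n]$; whp means with probability tending to $1$ as $n\to\infty$. *)

(* Defs.v *)
From HB Require Import structures.
From mathcomp Require Import all_boot all_order all_algebra.
From mathcomp Require Import zify.

Set Implicit Arguments.
Unset Strict Implicit.
Unset Printing Implicit Defensive.

Import Order.TTheory GRing.Theory Num.Theory.

Local Open Scope ring_scope.

(* A simple graph on 'I_n is an arbitrary set of two-element vertex sets. *)
Definition edge (n : nat) := {e : {set 'I_n} | #|e| == 2%N}.
Definition graph (n : nat) := {set edge n}.

Section Graph.
Variables (n : nat) (G : graph n).

Definition neighbours (v : 'I_n) : {set 'I_n} :=
  [set u | [exists e in G, val e == [set u; v]]].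

Definition degree (v : 'I_n) : nat := #|neighbours v|.

Definition edges_to (v : 'I_n) (S : {set 'I_n}) : nat :=
  #|neighbours v :&: S|.

Definition edges_within (S : {set 'I_n}) : nat :=
  #|[set e in G | val e \subset S]|.

Definition volume (S : {set 'I_n}) : nat := (\sum_(v in S) degree v)%N.

(* If G has no edges, the value is 0, since 0^-1 = 0. *)
Definition modularity_score (F : fieldType) (P : {set {set 'I_n}}) : F :=
  (#|G|%:R)^-1 * (\sum_(S in P) (edges_within S)%:R)
  - (4 * #|G|%:R ^+ 2)^-1 * (\sum_(S in P) (volume S)%:R ^+ 2).

End Graph.

Section Swap.
Variable n : nat.

(* The element v : 'I_n stands for the vertex v + 1 of [n] = {1, ..., n}. *)
Definition label (v : 'I_n) : nat := v.+1.

Definition swap_k : nat := n %/ 6.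

Definition V0 : {set 'I_n} := [set v | (label v <= 4 * swap_k)%N].
Definition V1 : {set 'I_n} :=
  [set v | (4 * swap_k < label v <= 6 * swap_k)%N].
Definition V2 : {set 'I_n} := [set v | (6 * swap_k < label v)%N].

Definition oddV : {set 'I_n} := [set v | odd (label v)].
Definition evenV : {set 'I_n} := [set v | ~~ odd (label v)].

Definition A1 := oddV :&: V1.
Definition B1 := evenV :&: V1.
Definition A2 := oddV :&: V2.
Definition B2 := evenV :&: V2.

Lemma swap_a_subproof (i : 'I_(2 * swap_k)) : (2 * i < n)%N.
Proof. by case: i => i /=; rewrite /swap_k; lia. Qed.

Lemma swap_b_subproof (i : 'I_(2 * swap_k)) : ((2 * i).+1 < n)%N.
Proof. by case: i => i /=; rewrite /swap_k; lia. Qed.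

(* The index i : 'I_(2k) stands for i + 1 in [2k], so that the labels of
   swap_a i and swap_b i are 2(i+1) - 1 and 2(i+1). *)
Definition swap_a (i : 'I_(2 * swap_k)) : 'I_n := Ordinal (swap_a_subproof i).
Definition swap_b (i : 'I_(2 * swap_k)) : 'I_n := Ordinal (swap_b_subproof i).

Variable G : graph n.

Definition swap_T (i : 'I_(2 * swap_k)) : int :=
  (edges_to G (swap_a i) B1)%:Z - (edges_to G (swap_a i) A1)%:Z
  + (edges_to G (swap_b i) A1)%:Z - (edges_to G (swap_b i) B1)%:Z.

Definition swap_a' i : 'I_n := if 0 < swap_T i then swap_b i else swap_a i.
Definition swap_b' i : 'I_n := if 0 < swap_T i then swap_a i else swap_b i.

Definition A0' : {set 'I_n} := [set swap_a' i | i : 'I_(2 * swap_k)].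
Definition B0' : {set 'I_n} := [set swap_b' i | i : 'I_(2 * swap_k)].

Definition swap_output : {set {set 'I_n}} :=
  [set A0' :|: A1 :|: A2; B0' :|: B1 :|: B2].

End Swap.

(* Each of the 'C(n, 2) possible edges is present independently with
   probability p. *)
Definition gnp_mass (R : comNzRingType) (n : nat) (p : R) (G : graph n) : R :=
  \prod_(e : edge n) (if e \in G then p else 1 - p).

Definition gnp_prob (R : comNzRingType) (n : nat) (p : R)
    (Q : pred (graph n)) : R :=
  \sum_(G : graph n | Q G) gnp_mass p G.

(* Main.v *)
(** Let [s] be the sign of a vertex (+1 on one part, -1 on the other), [m] the
number of edges, [S] the sum over edges [uv] of [s u * s v] and [D] the sum
over edges of [s u + s v].  The score of the bipartition is
[S / (2 m) - D^2 / (8 m^2)].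

The edges between [V0] and [V1] contribute exactly the sum of the [|T_i|] to
[S], and the [T_i] are independent.  Given these edges the signs are frozen, so
the other edges contribute a sum of centred independent terms; its fluctuations,
those of the sum of the [|T_i|], and those of [m] are controlled by Chebyshev's
inequality.  Choosing the signs of the pairs affects [D] by at most the sum of
the [|R_i|], where [R_i = e(a_i, V1) - e(b_i, V1)] has the same law as [T_i];
this costs only a multiple of [x^2], where [x = sqrt ((1 - p) / (n p)) <= 1].

For the mean of [|T_i|]: [T_i] is a lazy simple random walk of [2k] steps, and
the mean of [|.|] after [M] genuine steps is the partial sum of the return
probabilities ['C(2j, j) / 4^j], which is about [sqrt (2 M / pi)].  The square
root is bounded below by a quadratic polynomial in [M], so that only two
moments of the number of genuine steps are needed. *)

Require Import Defs.
From mathcomp Require Import all_boot all_order all_algebra.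
From mathcomp Require Import zify ring lra.
Import Order.TTheory GRing.Theory Num.Theory.
Local Open Scope ring_scope.

Set Implicit Arguments.
Unset Strict Implicit.
Unset Printing Implicit Defensive.

(** * Expectation over the random graph *)

Section Expectation.
Variables (R : realFieldType) (n : nat) (p : R).
Hypothesis p01 : 0 <= p <= 1.
Implicit Types (G H : graph n) (e f : edge n) (D : {set edge n}).

Definition Ex (F : graph n -> R) : R := \sum_(G : graph n) gnp_mass p G * F G.

(** Measurability with respect to the edge indicators in [D]. Independence is expressed through it:
    functions that depend on disjoint edge sets are independent. *)
Definition depends_on (T : Type) D (F : graph n -> T) :=
  forall G H, {in D, forall e, (e \in G) = (e \in H)} -> F G = F H.

Definition centred e G : R := (e \in G)%:R - p.

Lemma mass_ge0 G : 0 <= gnp_mass p G.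
Proof. by apply: prodr_ge0 => e _; case: ifP; case/andP: p01 => *; lra. Qed.

Lemma eq_Ex F1 F2 : F1 =1 F2 -> Ex F1 = Ex F2.
Proof. by move=> eqF; apply: eq_bigr => G _; rewrite eqF. Qed.

Lemma ExD F1 F2 : Ex (fun G => F1 G + F2 G) = Ex F1 + Ex F2.
Proof. by rewrite -big_split; apply: eq_bigr => G _; rewrite mulrDr. Qed.

Lemma ExZ c F : Ex (fun G => c * F G) = c * Ex F.
Proof. by rewrite mulr_sumr; apply: eq_bigr => G _; rewrite mulrCA. Qed.

Lemma Ex_sum (I : finType) (F : I -> graph n -> R) :
  Ex (fun G => \sum_i F i G) = \sum_i Ex (F i).
Proof. by rewrite exchange_big; apply: eq_bigr => G _; rewrite mulr_sumr. Qed.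

Lemma le_Ex F1 F2 : (forall G, F1 G <= F2 G) -> Ex F1 <= Ex F2.
Proof. by move=> leF; apply: ler_sum => G _; rewrite ler_wpM2l ?mass_ge0. Qed.

Lemma Ex_cst c : Ex (fun=> c) = c.
Proof.
rewrite /Ex -mulr_suml.
suff -> : \sum_(G : graph n) gnp_mass p G = 1 by rewrite mul1r.
by rewrite -(bigA_distr _ _ (fun=> p) (fun=> 1 - p)) big1 // => e _; rewrite /= addrCA subrr addr0.
Qed.

Lemma graph_sum_split e (F : graph n -> R) :
  \sum_G F G = \sum_(G : graph n | e \notin G) (F G + F (e |: G)).
Proof.
rewrite (bigID (fun G : graph n => e \notin G)) big_split /=; congr (_ + _).
rewrite (reindex_onto (fun G => e |: G) (fun G => G :\ e)) /=; last first.
  by move=> G; rewrite negbK => eG; rewrite setD1K.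
apply: eq_bigl => G; rewrite setU11 /=; apply/eqP/idP => [<-|eG].
  by rewrite !inE eqxx.
by rewrite setU1K.
Qed.

Lemma mass_split e G : e \notin G -> exists c,
  gnp_mass p G = (1 - p) * c /\ gnp_mass p (e |: G) = p * c.
Proof.
move=> eG; exists (\prod_(f | f != e) if f \in G then p else 1 - p).
split; rewrite /gnp_mass (bigD1 e) //= ?(negbTE eG) ?setU11 //; congr (_ * _).
by apply: eq_bigr => f /negbTE fe; rewrite !inE fe.
Qed.

(** Conditioning on all edges other than [e]. Later uses of independence go through this
    identity. *)
Lemma Ex_resample e F :
  Ex F = Ex (fun G => p * F (e |: G) + (1 - p) * F (G :\ e)).
Proof.
rewrite /Ex !(graph_sum_split e); apply: eq_bigr => G eG.
have [c [-> ->]] := mass_split eG.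
rewrite setUA setUid setU1K //.
have -> : G :\ e = G by apply/setDidPl; rewrite disjoint_sym disjoints1.
ring.
Qed.

Lemma depends_onU (T : Type) D e (F : graph n -> T) G :
  depends_on D F -> e \notin D -> F (e |: G) = F G.
Proof.
move=> DF eD; apply: DF => f fD; rewrite !inE.
by case: eqP fD eD => // -> ->.
Qed.

Lemma depends_onD (T : Type) D e (F : graph n -> T) G :
  depends_on D F -> e \notin D -> F (G :\ e) = F G.
Proof.
move=> DF eD; apply: DF => f fD; rewrite !inE.
by case: eqP fD eD => // -> ->.
Qed.

Lemma Ex_centred_mul D e F :
  depends_on D F -> e \notin D -> Ex (fun G => centred e G * F G) = 0.
Proof.
move=> DF eD; rewrite (Ex_resample e) -[RHS](Ex_cst 0); apply: eq_Ex => G.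
by rewrite (depends_onU _ DF) // (depends_onD _ DF) // /centred !inE eqxx /=; ring.
Qed.

Lemma Ex_centred_sqr e : Ex (fun G => centred e G ^+ 2) = p * (1 - p).
Proof.
rewrite (Ex_resample e) -[RHS]Ex_cst; apply: eq_Ex => G.
by rewrite /centred !inE eqxx /=; ring.
Qed.

Lemma Ex_sqr_sum (I : finType) (Y : I -> graph n -> R) (v : R) :
    (forall i, Ex (fun G => Y i G ^+ 2) <= v) ->
    (forall i j, i != j -> Ex (fun G => Y i G * Y j G) = 0) ->
  Ex (fun G => (\sum_i Y i G) ^+ 2) <= #|I|%:R * v.
Proof.
move=> diag cross.
rewrite (eq_Ex (F2 := fun G => \sum_i \sum_j Y i G * Y j G)); last first.
  by move=> G; rewrite expr2 mulr_suml; apply: eq_bigr => i _; rewrite mulr_sumr.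
rewrite Ex_sum mulr_natl -sumr_const; apply: ler_sum => i _.
rewrite Ex_sum (bigD1 i) //= big1 ?addr0 => [|j ji]; last by rewrite cross // eq_sym.
by apply: le_trans (diag i); rewrite le_eqVlt (eq_Ex (F2 := fun G => Y i G ^+ 2)) ?eqxx.
Qed.

(** The coefficients may be random as long as [D] determines them and they vanish on [D].
    Conditionally on [D] the sum then consists of independent centred terms, so the cross terms
    disappear. *)
Lemma Ex_centred_sum D (a : edge n -> graph n -> R) (B : R) :
    (forall e, depends_on D (a e)) -> {in D, forall e G, a e G = 0} ->
    (forall e G, `|a e G| <= B) ->
  Ex (fun G => (\sum_e a e G * centred e G) ^+ 2)
    <= #|{: edge n}|%:R * (B ^+ 2 * (p * (1 - p))).
Proof.
move=> Da a0 aB; apply: Ex_sqr_sum => [e|e f ef].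
  rewrite -(Ex_centred_sqr e) -ExZ; apply: le_Ex => G; rewrite exprMn.
  rewrite ler_wpM2r ?sqr_ge0 // -[_ ^+ 2]real_normK ?num_real //.
  by rewrite lerXn2r // ?nnegrE // (le_trans _ (aB e G)).
have [eD|eD] := boolP (e \in D).
  by rewrite -[RHS](Ex_cst 0); apply: eq_Ex => G; rewrite a0 // !mul0r.
(* Since [e] is outside [D] and differs from [f], everything but [centred e] depends on [f |: D],
   which does not contain [e]. *)
rewrite (eq_Ex (F2 := fun G => centred e G * (a e G * a f G * centred f G))); last by move=> G; ring.
apply: (@Ex_centred_mul (f |: D)); last by rewrite !inE negb_or ef.
move=> G H GH; rewrite /centred GH ?setU11 //.
by rewrite (Da e G H) 1?(Da f G H) // => g gD; apply: GH; rewrite setU1r.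
Qed.

Lemma gnp_prob_Ex (Q : pred (graph n)) : gnp_prob p Q = Ex (fun G => (Q G)%:R).
Proof.
rewrite /gnp_prob big_mkcond; apply: eq_bigr => G _.
by case: (Q G); rewrite ?mulr1 ?mulr0.
Qed.

Lemma gnp_prob_le1 (Q : pred (graph n)) : gnp_prob p Q <= 1.
Proof. by rewrite gnp_prob_Ex -[leRHS]Ex_cst; apply: le_Ex => G; case: (Q G). Qed.

Lemma chebyshev_union (I : finType) (Q : pred (graph n)) (Y : I -> graph n -> R)
    (t w : I -> R) :
    (forall i, 0 < t i) -> (forall i, Ex (fun G => Y i G ^+ 2) <= w i * t i ^+ 2) ->
    (forall G, (forall i, `|Y i G| <= t i) -> Q G) ->
  1 - \sum_i w i <= gnp_prob p Q.
Proof.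
move=> t0 Yw YQ; rewrite lerBlDr gnp_prob_Ex.
(* Pointwise, either [Q] holds or some [(Y i / t i)^2] exceeds 1. This merges Chebyshev's inequality
   with the union bound. *)
have : Ex (fun G => (Q G)%:R + \sum_i (t i ^- 2) * Y i G ^+ 2) >= 1.
  rewrite -[leLHS]Ex_cst; apply: le_Ex => G.
  have s0 i : 0 <= t i ^- 2 * Y i G ^+ 2.
    by rewrite mulr_ge0 ?sqr_ge0 // invr_ge0 sqr_ge0.
  have [QG|nQ] := boolP (Q G); first by rewrite lerDl sumr_ge0.
  have /existsP [i] : [exists i, t i < `|Y i G|].
    rewrite -[X in is_true X]negbK negb_exists; apply: contra nQ => /forallP h.
    by apply: YQ => i; have := h i; rewrite -leNgt.
  move=> ti; rewrite (bigD1 i) //= add0r; apply: le_trans (_ : t i ^- 2 * Y i G ^+ 2 <= _); last first.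
    by rewrite lerDl sumr_ge0.
  rewrite mulrC ler_pdivlMr ?exprn_gt0 // mul1r -[leRHS]real_normK ?num_real //.
  by rewrite lerXn2r ?nnegrE // ltW.
move/le_trans; apply; rewrite ExD Ex_sum lerD2l; apply: ler_sum => i _.
by rewrite ExZ mulrC ler_pdivrMr ?exprn_gt0.
Qed.

End Expectation.

(** * The lazy simple random walk *)

Section Walk.
Variable R : realFieldType.
Implicit Types (phi : int -> R) (x : int) (r : R).

(** The walk is encoded by its Markov operator on test functions: [iter N step phi x] is the mean of
    [phi] after [N] steps started at [x]. In [lazy_step r] a genuine step is made with probability
    [r]. *)
Definition step phi x : R := (phi (x - 1) + phi (x + 1)) / 2.
Definition lazy_step r phi x : R := (1 - r) * phi x + r * step phi x.

Lemma iter_lazy_lin r N c1 c2 phi1 phi2 x :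
  iter N (lazy_step r) (fun y => c1 * phi1 y + c2 * phi2 y) x
  = c1 * iter N (lazy_step r) phi1 x + c2 * iter N (lazy_step r) phi2 x.
Proof.
elim: N x => [//|N IH] x.
by rewrite !iterS /lazy_step /step !IH; ring.
Qed.

Lemma iter_lazy_sqr r N x :
  iter N (lazy_step r) (fun y => y%:~R ^+ 2) x = x%:~R ^+ 2 + N%:R * r.
Proof.
elim: N x => [|N IH] x; first by rewrite mul0r addr0.
rewrite iterS /lazy_step /step !IH -natr1 !intrD !intrN; by field.
Qed.

Definition absR x : R := `|x|%:~R.

Definition return_prob j : R := iter j step (fun y => (y == 0)%:R) 0.

Lemma return_prob_ge0 j : 0 <= return_prob j.
Proof.
suff h x : 0 <= iter j step (fun y => (y == 0)%:R) x by apply: h.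
elim: j x => [|j IH] x; first exact: ler0n.
by rewrite iterS /step divr_ge0 // addr_ge0.
Qed.

Lemma iter_step_support j x : j%:Z < x -> iter j step (fun y => (y == 0)%:R) x = 0.
Proof.
elim: j x => [|j IH] x jx /=; first by rewrite gt_eqF.
by rewrite /step !IH ?addr0 ?mul0r //; lia.
Qed.

(** Going from [j - 2 l] to 0 in [j] steps takes exactly [l] up-steps. The induction is Pascal's
    rule; for [l = 0] the second term vanishes because its starting point is out of reach. *)
Lemma iter_step_bin j l :
  iter j step (fun y => (y == 0)%:R) (j%:Z - 2 * l%:Z) = 'C(j, l)%:R / 2 ^+ j.
Proof.
elim: j l => [|j IH] [|l].
- by rewrite /= bin0 divr1.
- by rewrite bin0n mul0r /iter (_ : (_ == _) = false) ?mulr0n //; lia.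
- rewrite iterS /step (_ : _ + 1 = j%:Z + 2); last by lia.
  rewrite (_ : _ - 1 = j%:Z - 2 * 0%:Z); last by lia.
  rewrite IH iter_step_support ?bin0 ?exprS; last by lia.
  by field; rewrite expf_neq0 // pnatr_eq0.
- rewrite iterS /step (_ : _ + 1 = j%:Z - 2 * l%:Z); last by lia.
  rewrite (_ : _ - 1 = j%:Z - 2 * l.+1%:Z); last by lia.
  by rewrite !IH binS natrD exprS; field; rewrite expf_neq0 // pnatr_eq0.
Qed.

Lemma return_prob_even j : return_prob j.*2 = 'C(j.*2, j)%:R / 4 ^+ j.
Proof.
rewrite /return_prob; have := iter_step_bin j.*2 j; rewrite (_ : _ - _ = 0) => [->|]; last by lia.
by rewrite -mul2n exprM; congr (_ / _ ^+ _); ring.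
Qed.

Lemma return_prob_evenS j :
  (j.*2.+2)%:R * return_prob j.+1.*2 = (j.*2.+1)%:R * return_prob j.*2.
Proof.
rewrite !return_prob_even exprS.
have h : (j.+1 * 'C(j.+1.*2, j.+1) = 2 * (j.*2.+1 * 'C(j.*2, j)))%N.
  have := mul_bin_diag j.*2.+1 j; have := mul_bin_left j.*2.+1 j.
  have := mul_bin_diag j.*2 j; have := mul_bin_left j.*2 j; have := binS j.*2.+1 j.
  have := binS j.*2 j; rewrite doubleS.
  have := mul_bin_down j.*2 j.
  rewrite (_ : j.*2 - j = j)%N; last by lia.
  rewrite (_ : j.*2.+1 - j = j.+1)%N; last by lia.
  nia.
have : (j.+1)%:R * 'C(j.+1.*2, j.+1)%:R = 2 * ((j.*2.+1)%:R * 'C(j.*2, j)%:R) :> R.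
  by rewrite -!natrM h.
have p4 : (4 : R) ^+ j != 0 by rewrite expf_neq0 // pnatr_eq0.
move: ('C(_, _)%:R) ('C(_, _)%:R) => u v e.
rewrite -doubleS -[j.+1.*2]muln2 natrM.
rewrite mulrA [_ * 2 * _](_ : _ = 2 * ((j.+1)%:R * v)); last by ring.
rewrite e; by field; rewrite p4.
Qed.

Definition mean_abs M : R := iter M step absR 0.

(** Discrete Tanaka formula: one step preserves the mean of [|x|] away from 0 and raises it by 1 at
    0. *)
Lemma mean_absS M : mean_abs M.+1 = mean_abs M + return_prob M.
Proof.
suff h x : iter M.+1 step absR x
    = iter M step absR x + iter M step (fun y => (y == 0)%:R) x by apply: h.
elim: M x => [|M IH] x; last first.
  rewrite [LHS](_ : _ = step (iter M.+1 step absR) x) // [LHS]/step.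
  by rewrite (IH (x - 1)) (IH (x + 1)) /= /step; field.
rewrite /= /step /absR; case: (ltrgtP x 0) => [x0|x0|->]; last first.
- by rewrite sub0r add0r normrN normr1 normr0 mulr1n mulr0z; field.
- rewrite (ger0_norm (_ : 0 <= x - 1)); last by lia.
  rewrite (ger0_norm (_ : 0 <= x + 1)) ?(ger0_norm (_ : 0 <= x)); [|by lia..].
  by rewrite mulr0n !intrD intrN; field.
- rewrite (ler0_norm (_ : x - 1 <= 0)); last by lia.
  rewrite (ler0_norm (_ : x + 1 <= 0)) ?(ler0_norm (_ : x <= 0)); [|by lia..].
  by rewrite mulr0n !intrN !intrD !intrN; field.
Qed.

Lemma mean_abs_ge0 M : 0 <= mean_abs M.
Proof.
elim: M => [|M IH]; first by rewrite /mean_abs /absR /= normr0.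
by rewrite mean_absS addr_ge0 ?return_prob_ge0.
Qed.

(** By [return_prob_evenS], [2m * return_prob (2m)] grows by exactly [return_prob (2m)] when [m]
    becomes [m + 1], so it telescopes against the partial sums of return probabilities. With
    [h = uphalf M], [M] is [2h] or [2h - 1], and the bound already holds at time [2h - 1]. *)
Lemma mean_abs_half M : (uphalf M).*2%:R * return_prob (uphalf M).*2 <= mean_abs M.
Proof.
have even m : m.+1.*2%:R * return_prob m.+1.*2 = m.*2%:R * return_prob m.*2 + return_prob m.*2.
  by rewrite doubleS return_prob_evenS -natr1; ring.
have mono A B : (A <= B)%N -> mean_abs A <= mean_abs B.
  move=> /subnK <-; elim: (_ - _)%N => [//|d IH].
  by rewrite addSn mean_absS ler_wpDr ?return_prob_ge0.
have odd m : m.+1.*2%:R * return_prob m.+1.*2 <= mean_abs m.*2.+1.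
  rewrite even mean_absS lerD2r; elim: m => [|m IH]; first by rewrite mul0r mean_abs_ge0.
  by rewrite even mean_absS ler_wpDr ?return_prob_ge0 // mean_absS lerD2r.
have : M = (uphalf M).*2 \/ M = (uphalf M).-1.*2.+1 /\ (0 < uphalf M)%N by lia.
case: (uphalf M) => [|m] //=; first by rewrite mul0r mean_abs_ge0.
move=> h; apply: le_trans (odd m) _; apply: mono; lia.
Qed.

(** The Wallis sequence, which increases to 2/pi: with [y = 2m] the ratio of consecutive terms is
    [(y + 1)^2 / (y (y + 2))]. Each fixed [j] therefore yields an explicit constant for the
    square-root bound. *)
Lemma return_prob_sqr_mono j m : (0 < j <= m)%N ->
  j.*2%:R * return_prob j.*2 ^+ 2 <= m.*2%:R * return_prob m.*2 ^+ 2.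
Proof.
case/andP=> j0 /subnK <-; elim: (_ - _)%N => [//|d IH].
rewrite addSn; move: (d + j)%N IH => {d}m IH; have /= e := return_prob_evenS m.
apply: le_trans IH _; rewrite doubleS.
move: (return_prob m.+1.*2) (return_prob m.*2) e => u b.
rewrite -[m.*2.+2]addn2 -[m.*2.+1]addn1 !natrD.
move: (m.*2%:R) (ler0n R m.*2) => y y0 e.
have y2 : y + 2 != 0 by rewrite gt_eqF //; lra.
have -> : u = (y + 1) / (y + 2) * b by rewrite mulrAC -e mulrC mulKf.
have -> : (y + 2) * ((y + 1) / (y + 2) * b) ^+ 2 = (y + 1) ^+ 2 / (y + 2) * b ^+ 2 by field.
rewrite ler_wpM2r ?sqr_ge0 // ler_pdivlMr; first nra; lra.
Qed.

End Walk.

(** * Signed differences of edge indicators as a lazy walk *)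

Section WalkGnp.
Variables (R : realFieldType) (n : nat) (p : R).

(** The difference of two independent indicators is 1 or -1 with probability [p (1 - p)] each, hence
    a lazy step with [r = 2 p (1 - p)]. The factor [F] makes the statement include independence from
    the edges in [D]. *)
Lemma Ex_walk (J : eqType) (l : seq J) (eta : J -> int) (a b : J -> edge n)
    (D : {set edge n}) (F : graph n -> R) (phi : int -> R) (x : int) :
    depends_on D F -> {in l, forall j, eta j = 1 \/ eta j = -1} ->
    uniq (map a l ++ map b l) -> {in l, forall j, a j \notin D /\ b j \notin D} ->
  Ex p (fun G => phi (x + \sum_(j <- l) eta j * ((a j \in G)%:Z - (b j \in G)%:Z)) * F G)
  = iter (size l) (lazy_step (2 * (p * (1 - p)))) phi x * Ex p F.
Proof.
move=> DF; elim: l phi x => [|j l IH] phi x etaP abU abD.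
  rewrite /= -[phi x * _]ExZ; apply: eq_Ex => G.
  by rewrite big_nil addr0.
have /and3P [] : uniq (a j :: b j :: (map a l ++ map b l)).
  rewrite -(perm_uniq (_ : perm_eq (map a (j :: l) ++ map b (j :: l)) _)) //.
  by rewrite /= perm_cons -[b j :: _]cat1s perm_catCA.
rewrite inE negb_or => /andP [ab aj] bj abU'.
rewrite [size _]/= iterSr -IH //; last 2 first.
- by move=> i il; apply: etaP; rewrite inE il orbT.
- by move=> i il; apply: abD; rewrite inE il orbT.
have [aD bD] : a j \notin D /\ b j \notin D by apply: abD; rewrite inE eqxx.
have restE (e : edge n) (G H : graph n) :
    e \notin map a l ++ map b l -> (forall f, f != e -> (f \in G) = (f \in H)) ->
    \sum_(i <- l) eta i * ((a i \in G)%:Z - (b i \in G)%:Z)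
    = \sum_(i <- l) eta i * ((a i \in H)%:Z - (b i \in H)%:Z).
  rewrite mem_cat negb_or => /andP [ea eb] GH; apply: eq_big_seq => i il.
  rewrite !GH //; first by apply: contraNneq eb => <-; apply: map_f.
  by apply: contraNneq ea => <-; apply: map_f.
pose S (G : graph n) := \sum_(i <- l) eta i * ((a i \in G)%:Z - (b i \in G)%:Z).
have SU (e : edge n) (G : graph n) : e \notin map a l ++ map b l -> S (e |: G) = S G.
  by move=> he; apply: restE he _ => f /negbTE fe; rewrite !inE fe.
have SD (e : edge n) (G : graph n) : e \notin map a l ++ map b l -> S (G :\ e) = S G.
  by move=> he; apply: restE he _ => f fe; rewrite !inE fe.
(* Once both edges of [j] are resampled on each side, the two integrands agree pointwise. *)
rewrite [LHS](Ex_resample _ (a j)) [LHS](Ex_resample _ (b j)).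
rewrite [RHS](Ex_resample _ (a j)) [RHS](Ex_resample _ (b j)).
apply: eq_Ex => G; rewrite !big_cons -!/(S _) !SU ?SD ?SU ?SD //.
rewrite !(depends_onU _ DF) // ?(depends_onD _ DF) // !(depends_onU _ DF) // ?(depends_onD _ DF) //.
rewrite !inE !eqxx (negbTE ab) eq_sym (negbTE ab) /= /lazy_step /step.
have e0 (c : int) : x + (c * (1%:Z - 1%:Z) + S G) = x + S G by ring.
have e1 (c : int) : x + (c * (0%:Z - 0%:Z) + S G) = x + S G by ring.
rewrite !(e0, e1); have [->|->] := etaP j (mem_head _ _).
  rewrite (_ : x + (1 * (0%:Z - 1%:Z) + S G) = x + S G - 1); last by ring.
  rewrite (_ : x + (1 * (1%:Z - 0%:Z) + S G) = x + S G + 1); last by ring.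
  by field.
rewrite (_ : x + (-1 * (0%:Z - 1%:Z) + S G) = x + S G + 1); last by ring.
rewrite (_ : x + (-1 * (1%:Z - 0%:Z) + S G) = x + S G - 1); last by ring.
by field.
Qed.

End WalkGnp.

(** * Lower bounds for the mean absolute value of the lazy walk *)

Section WalkBound.
Variable R : rcfType.

Definition mean_abs_lazy (r : R) N : R := iter N (lazy_step r) (absR R) 0.

(* A lazy walk of N steps makes Bin(N, r) genuine steps, so a quadratic
   minorant of mean_abs can be averaged with two binomial moments. *)
Lemma mean_abs_lazy_quadratic (r al be d : R) N : 0 <= r <= 1 ->
    (forall M, al * M%:R - be * M%:R ^+ 2 - d <= mean_abs R M) ->
  al * (N%:R * r) - be * ((N%:R * r) ^+ 2 + N%:R * r * (1 - r)) - d
    <= mean_abs_lazy r N.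
Proof.
(* [E j k] is the mean of the quadratic at [j + Bin(k, r)]. The induction resolves one lazy step at
   a time into a genuine step or a pause. *)
move=> r01 quad; pose E (j : R) (k : R) := al * (j + k * r)
  - be * ((j + k * r) ^+ 2 + k * r * (1 - r)) - d.
have gen j : E j%:R N%:R <= iter N (lazy_step r) (iter j (@step R) (absR R)) 0.
  elim: N j => [|N IH] j.
    by apply: le_trans (quad j); rewrite /E mul0r addr0 mul0r addr0.
  have -> : iter N.+1 (lazy_step r) (iter j (@step R) (absR R)) 0
      = (1 - r) * iter N (lazy_step r) (iter j (@step R) (absR R)) 0
        + r * iter N (lazy_step r) (iter j.+1 (@step R) (absR R)) 0.
    by rewrite iterSr -iter_lazy_lin.
  have -> : E j%:R N.+1%:R = (1 - r) * E j%:R N%:R + r * E j.+1%:R N%:R.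
    by rewrite /E -!natr1; ring.
  by rewrite lerD // ler_wpM2l ?IH //; lra.
by have := gen 0%N; rewrite /E !add0r.
Qed.

Lemma mean_abs_sqr_ge j M : (0 < j)%N -> (j <= uphalf M)%N ->
  j.*2%:R * return_prob R j.*2 ^+ 2 * M%:R <= mean_abs R M ^+ 2.
Proof.
move=> j0 jM; set h := uphalf M.
have v0 : 0 <= h.*2%:R * return_prob R h.*2 by rewrite mulr_ge0 ?return_prob_ge0.
apply: (@le_trans _ _ ((h.*2%:R * return_prob R h.*2) ^+ 2)); last first.
  by rewrite lerXn2r ?nnegrE ?mean_abs_ge0 // mean_abs_half.
have -> : (h.*2%:R * return_prob R h.*2) ^+ 2
   = h.*2%:R * return_prob R h.*2 ^+ 2 * h.*2%:R by ring.
have le1 : j.*2%:R * return_prob R j.*2 ^+ 2 <= h.*2%:R * return_prob R h.*2 ^+ 2.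
  by apply: return_prob_sqr_mono; rewrite j0.
apply: ler_pM => //; first by rewrite mulr_ge0 ?sqr_ge0.
by rewrite ler_nat /h; lia.
Qed.

Lemma sqrt_le_mean_abs (c : R) j M : 0 <= c -> (0 < j)%N -> (j <= uphalf M)%N ->
  c ^+ 2 <= j.*2%:R * return_prob R j.*2 ^+ 2 -> c * Num.sqrt M%:R <= mean_abs R M.
Proof.
move=> c0 j0 jM cj; rewrite -(@ler_pXn2r _ 2) // ?nnegrE ?mean_abs_ge0 ?mulr_ge0 ?sqrtr_ge0 //.
apply: le_trans (mean_abs_sqr_ge j0 jM).
by rewrite exprMn sqr_sqrtr // ler_wpM2r.
Qed.

(** Here [j = 1]: [2 (1/2)^2 = 1/2] is at least [(7/10)^2]. The term [- 0] gives the shape that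
    [mean_abs_lazy_ge] expects. *)
Lemma mean_abs_ge_7 M : 7 / 10 * Num.sqrt M%:R - 0 <= mean_abs R M.
Proof.
case: M => [|M]; first by rewrite sqrtr0 mulr0 subr0 mean_abs_ge0.
rewrite subr0; apply: (@sqrt_le_mean_abs _ 1) => //.
  lra.
have -> := return_prob_even R 1.
by rewrite (_ : 'C(1.*2, 1) = 2)%N // (_ : 1.*2 = 2)%N //; lra.
Qed.

(** Here [j = 3]: [6 (20/64)^2 = 0.5859...] exceeds [0.765^2]. This requires [M >= 5]; for smaller
    [M] the left side is negative thanks to the loss of 2. *)
Lemma mean_abs_ge_765 M : 765 / 1000 * Num.sqrt M%:R - 2 <= mean_abs R M.
Proof.
have [M4|M4] := leqP M 4.
  apply: le_trans (mean_abs_ge0 R M).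
  have : Num.sqrt (M%:R : R) <= Num.sqrt (2 ^+ 2).
    by rewrite ler_wsqrtr // -natrX ler_nat.
  by rewrite sqrtr_sqr ger0_norm //; lra.
have h : 765 / 1000 * Num.sqrt M%:R <= mean_abs R M.
  apply: (@sqrt_le_mean_abs _ 3) => //; [lra|lia|].
  have -> := return_prob_even R 3.
  by rewrite (_ : 'C(3.*2, 3) = 20)%N // (_ : 3.*2 = 6)%N //; lra.
lra.
Qed.

(** The quadratic minorant is the one through 0 that touches [c sqrt M] at [M = s^2 = 1 + mu]. This
    contact point suits the second moment [mu^2 + mu (1 - r)], which is at most [mu s^2]. *)
Lemma mean_abs_lazy_ge (r c d : R) N : 0 <= r <= 1 -> 0 <= c ->
    (forall M, c * Num.sqrt M%:R - d <= mean_abs R M) ->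
  c * (N%:R * r) / Num.sqrt (1 + N%:R * r) - d <= mean_abs_lazy r N.
Proof.
move=> r01 c0 cd; set mu := N%:R * r; set s := Num.sqrt _.
have mu0 : 0 <= mu by rewrite mulr_ge0 //; lra.
have s2 : s ^+ 2 = 1 + mu by rewrite sqr_sqrtr //; lra.
have s0 : 0 < s by rewrite sqrtr_gt0; lra.
have := @mean_abs_lazy_quadratic r (3 * c / (2 * s)) (c / (2 * s ^+ 3)) d N r01.
rewrite -/mu => /(_ _) h; apply: le_trans (h _) => {h}; last first.
  move=> M; apply: le_trans (cd M); rewrite lerD2r.
  (* 2z >= 3z^2 - z^4 for z = sqrt M / s *)
  set t := Num.sqrt _; have t0 : 0 <= t by rewrite sqrtr_ge0.
  have -> : M%:R = t ^+ 2 by rewrite sqr_sqrtr.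
  have [z0 ->] : 0 <= t / s /\ t = t / s * s.
    by split; [rewrite divr_ge0 // ltW | rewrite divfK // gt_eqF].
  move: (t / s) z0 => z z0.
  have -> : 3 * c / (2 * s) * (z * s) ^+ 2 - c / (2 * s ^+ 3) * ((z * s) ^+ 2) ^+ 2
     = c * s * (3 * z ^+ 2 - z ^+ 4) / 2 by field; rewrite gt_eqF.
  have k0 : 0 <= c * s by rewrite mulr_ge0 // ltW.
  have hz : 0 <= z * (z + 2) * (z - 1) ^+ 2 by rewrite mulr_ge0 ?sqr_ge0 //; nra.
  rewrite (_ : c * (z * s) = c * s * z); last by ring.
  by move: (c * s) k0 => k k0; have := mulr_ge0 k0 hz; lra.
rewrite lerD2r -subr_ge0 (_ : _ - _ = c * mu * r / (2 * s ^+ 3)).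
  by rewrite divr_ge0 ?mulr_ge0 ?exprn_ge0 ?(ltW s0) //; lra.
have -> : mu = s ^+ 2 - 1 by lra.
by field; rewrite gt_eqF.
Qed.

Lemma mean_abs_lazy_ge_large (r : R) N : 0 <= r <= 1 -> 1000 ^+ 2 <= N%:R * r ->
  76 / 100 * Num.sqrt (N%:R * r) <= mean_abs_lazy r N.
Proof.
move=> r01 mu_ge.
have c0 : 0 <= 765 / 1000 :> R by lra.
apply: le_trans _ (mean_abs_lazy_ge N r01 c0 mean_abs_ge_765).
have mu0 : 0 <= N%:R * r by rewrite mulr_ge0 //; lra.
have w_ge : 1000 <= Num.sqrt (N%:R * r).
  by rewrite -[leLHS](ger0_norm (ler0n R _)) -sqrtr_sqr ler_wsqrtr.
rewrite -[X in _ * X / _](sqr_sqrtr mu0) -[X in 1 + X](sqr_sqrtr mu0).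
move: (Num.sqrt (N%:R * r)) w_ge => w w_ge.
have s_gt0 : 0 < Num.sqrt (1 + w ^+ 2) by rewrite sqrtr_gt0 ltr_wpDr ?sqr_ge0.
have s_le : Num.sqrt (1 + w ^+ 2) <= w + 1.
  rewrite -[leRHS](ger0_norm (_ : 0 <= w + 1)); last by lra.
  by rewrite -sqrtr_sqr ler_wsqrtr //; nra.
(* Hence the bound is at least [0.765 (w - 1) - 2], which exceeds [0.76 w] since [w >= 1000]. *)
have : (w - 1) * Num.sqrt (1 + w ^+ 2) <= w ^+ 2 by nra.
rewrite -ler_pdivlMr // => h.
rewrite -mulrA; lra.
Qed.

Lemma mean_abs_lazy_ge_small (r : R) N : 0 <= r <= 1 -> 1 / 4 <= N%:R * r ->
  2 / 10 * Num.sqrt (N%:R * r) <= mean_abs_lazy r N.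
Proof.
move=> r01 mu_ge.
have c0 : 0 <= 7 / 10 :> R by lra.
apply: le_trans _ (mean_abs_lazy_ge N r01 c0 mean_abs_ge_7).
have mu0 : 0 <= N%:R * r by rewrite mulr_ge0 //; lra.
rewrite subr0 -[X in _ * X / _](sqr_sqrtr mu0).
have s0 : 0 < Num.sqrt (1 + N%:R * r) by rewrite sqrtr_gt0; lra.
rewrite ler_pdivlMr //.
(* The factor 7/2 is chosen so that [7/10 * 2/7 = 2/10]. *)
have s_le : 2 * Num.sqrt (1 + N%:R * r) <= 7 * Num.sqrt (N%:R * r).
  rewrite -(@ler_pXn2r _ 2) // ?nnegrE ?mulr_ge0 ?sqrtr_ge0 //.
  by rewrite !exprMn !sqr_sqrtr //; lra.
have := sqrtr_ge0 (N%:R * r); nra.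
Qed.

End WalkBound.

(** * Modularity of a bipartition as edge sums of signs *)

Section EdgeSums.
Variable n : nat.
Implicit Types (G : graph n) (e : edge n) (u v : 'I_n).

Lemma edge_set2 e : exists u v, u != v /\ val e = [set u; v].
Proof. by have /cards2P [u [v [uv ev]]] := valP e; exists u, v; split. Qed.

Lemma edge_neq (u v : 'I_n) e : val e = [set u; v] -> u != v.
Proof. by move=> ev; have := valP e; rewrite ev cards2; case: (u == v). Qed.

(** The edges at [v] correspond to the other vertices via [u -> {u, v}]. Taking [h] on vertex sets
    avoids constructing an edge from each pair. *)
Lemma sum_edges_at (V : nmodType) (h : {set 'I_n} -> V) v :
  \sum_(e : edge n | v \in val e) h (val e) = \sum_(u | u != v) h [set u; v].
Proof.
have injv : {in [pred u | u != v] &, injective (fun u => [set u; v])}.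
  move=> u w uv wv /setP /(_ u); rewrite !inE eqxx /= (negbTE uv) orbF.
  by move/esym/eqP.
have injE : {in [pred e : edge n | v \in val e] &, injective val}.
  by move=> e1 e2 _ _; apply: val_inj.
rewrite -(big_imset h injv) -(big_imset h injE); apply: eq_bigl => S.
apply/imsetP/imsetP => [[e ve ->]|[u uv ->]].
  have [u [w [uw ev]]] := edge_set2 e.
  move: ve; rewrite inE ev !inE => /orP [] /eqP ->; last by exists u.
  by exists w; rewrite ?inE 1?eq_sym // setUC.
have cuv : #|[set u; v]| == 2%N by rewrite cards2 (negbTE (uv : u != v)).
by exists (exist _ [set u; v] cuv); rewrite // inE /= !inE eqxx orbT.
Qed.

Lemma degreeE G v : degree G v = (\sum_(e in G) (v \in val e))%N.
Proof.
pose h (S : {set 'I_n}) : nat := [exists e in G, val e == S].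
have hE e : h (val e) = (e \in G).
  rewrite /h; congr nat_of_bool; apply/idP/idP => [/existsP [f /andP [fG /eqP /val_inj <-]] //|eG].
  by apply/existsP; exists e; rewrite eG eqxx.
rewrite /degree -sum1_card big_mkcond /= (bigD1 v) //= [X in (X + _)%N](_ : _ = 0%N).
  rewrite add0n (eq_bigr (fun u => h [set u; v])); last by move=> u _; rewrite inE.
  rewrite -(sum_edges_at h) big_mkcond [RHS]big_mkcond.
  by apply: eq_bigr => e _; rewrite hE; do 2!case: (_ \in _).
rewrite inE ifF //; apply/existsP => -[e /andP [_ /eqP ev]].
by have := edge_neq ev; rewrite eqxx.
Qed.

Lemma degree_complete v : degree [set: edge n] v = n.-1.
Proof.
rewrite degreeE -[RHS](_ : #|[set~ v]| = _); last by rewrite cardsC1 card_ord.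
rewrite -sum1_card [RHS](eq_bigl (fun u => u != v)); last by move=> u; rewrite !inE.
rewrite -(sum_edges_at (fun=> 1%N)) big_mkcond [RHS]big_mkcond.
by apply: eq_bigr => e _; rewrite inE; case: (_ \in _).
Qed.

Section Signs.
Variable R : realFieldType.
Implicit Types s : 'I_n -> R.

Definition esum s e : R := \sum_(v in val e) s v.
Definition eprod s e : R := \prod_(v in val e) s v.

Lemma esum2 s e u v : u != v -> val e = [set u; v] -> esum s e = s u + s v.
Proof. by move=> uv ev; rewrite /esum ev big_setU1 ?big_set1 // inE. Qed.

Lemma eprod2 s e u v : u != v -> val e = [set u; v] -> eprod s e = s u * s v.
Proof. by move=> uv ev; rewrite /eprod ev big_setU1 ?big_set1 // inE. Qed.

Lemma sum_degree G s : \sum_v s v * (degree G v)%:R = \sum_(e in G) esum s e.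
Proof.
under eq_bigr => v _ do rewrite degreeE natr_sum mulr_sumr.
rewrite exchange_big /=; apply: eq_bigr => e _; rewrite /esum [RHS]big_mkcond /=.
by apply: eq_bigr => v _; case: (v \in _); rewrite ?mulr1 ?mulr0.
Qed.

Lemma sum_esum s : \sum_e esum s e = n.-1%:R * \sum_v s v.
Proof.
transitivity (\sum_(e in [set: edge n]) esum s e).
  by apply: eq_bigl => e; rewrite inE.
by rewrite mulr_sumr -sum_degree; apply: eq_bigr => v _; rewrite degree_complete mulrC.
Qed.

Lemma sum_eprod s : 2 * \sum_e eprod s e = (\sum_v s v) ^+ 2 - \sum_v s v ^+ 2.
Proof.
have -> : 2 * \sum_e eprod s e = \sum_v \sum_(e : edge n | v \in val e) eprod s e.
  rewrite (exchange_big_dep xpredT) //= mulr_sumr; apply: eq_bigr => e _.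
  by rewrite sumr_const (eqP (valP e)) mulr_natl.
rewrite expr2 mulr_suml -sumrB; apply: eq_bigr => v _.
rewrite (sum_edges_at (fun S => \prod_(v in S) s v)) [X in _ = _ * X - _](bigD1 v) //=.
rewrite mulrDr expr2 addrAC subrr add0r.
rewrite mulr_sumr; apply: eq_bigr => u uv.
by rewrite big_setU1 ?big_set1 ?inE // mulrC.
Qed.

Lemma card_edge : 2 * #|{: edge n}|%:R = n%:R * n.-1%:R :> R.
Proof.
have := sum_esum (fun=> 1); rewrite sumr_const card_ord mulrC => <-.
rewrite mulr_natr -sumr_const; apply: eq_bigr => e _.
by rewrite /esum sumr_const (eqP (valP e)).
Qed.

(** The volumes have sum [2 m] and difference [D], so their squares add up to [(4 m^2 + D^2) / 2];
    the inner edges number [(m + S) / 2]. The constant terms cancel. *)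
Lemma modularity_two G (b : 'I_n -> bool) : (0 < n)%N -> G != set0 ->
  let s v : R := (-1) ^+ b v in
  modularity_score G R [set [set v | ~~ b v]; [set v | b v]]
  = (\sum_(e in G) eprod s e) / (2 * #|G|%:R)
    - (\sum_(e in G) esum s e) ^+ 2 / (8 * #|G|%:R ^+ 2).
Proof.
move=> n0 G0 s; have m0 : #|G|%:R != 0 :> R by rewrite pnatr_eq0 cards_eq0.
set A := [set v | ~~ b v]; set B := [set v | b v].
(* The partition is a set of sets, so equal parts would collapse to one; any vertex separates
   them. *)
have AB : A != B.
  apply/eqP => /setP /(_ (Ordinal n0)); rewrite !inE; by case: (b _).
rewrite /modularity_score !big_setU1 ?inE // !big_set1.
have vol S : (volume G S)%:R = \sum_(v in S) (degree G v)%:R :> R by rewrite natr_sum.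
have volD : (volume G A)%:R + (volume G B)%:R = 2 * #|G|%:R :> R.
  have := sum_degree G (fun=> 1).
  rewrite (bigID b) /= addrC.
  have -> : \sum_(e in G) esum (fun=> 1) e = 2 * #|G|%:R.
    rewrite mulr_natr -sumr_const; apply: eq_bigr => e _.
    by rewrite /esum sumr_const (eqP (valP e)).
  move=> <-; rewrite !vol; congr (_ + _).
    by apply: eq_big => v; rewrite ?inE // mul1r.
  by apply: eq_big => v; rewrite ?inE // mul1r.
have volB : (volume G A)%:R - (volume G B)%:R = \sum_(e in G) esum s e :> R.
  rewrite -sum_degree (bigID b) /= addrC !vol -sumrN; congr (_ + _).
    by apply: eq_big => v; rewrite ?inE // /s => /negbTE ->; rewrite mul1r.
  by apply: eq_big => v; rewrite ?inE // /s => ->; rewrite expr1 mulN1r.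
have win S : (edges_within G S)%:R = \sum_(e in G) (val e \subset S)%:R :> R.
  rewrite /edges_within -sum1_card natr_sum (eq_bigl (fun e => (e \in G) && (val e \subset S))).
    by rewrite big_mkcondr; apply: eq_bigr => e _; case: (_ \subset _).
  by move=> e; rewrite inE.
have winD : 2 * ((edges_within G A)%:R + (edges_within G B)%:R)
    = #|G|%:R + \sum_(e in G) eprod s e :> R.
  rewrite !win -sum1_card natr_sum -!big_split mulr_sumr; apply: eq_bigr => e _.
  have [u [v [uv ev]]] := edge_set2 e; rewrite (eprod2 _ uv ev) ev !subUset !sub1set !inE /s.
  by case: (b u); case: (b v); rewrite /= ?expr0 ?expr1; lra.
move: volD volB winD.
move: (volume G A)%:R (volume G B)%:R (edges_within G A)%:R (edges_within G B)%:R => x y z w.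
move: (#|G|%:R) m0 (\sum_(e in G) eprod s e) (\sum_(e in G) esum s e) => m m0 S D xy D2 zw.
rewrite -D2 (_ : S = 2 * (z + w) - m); last by lra.
rewrite (_ : y = 2 * m - x); last by lra.
by rewrite /=; field.
Qed.

End Signs.

End EdgeSums.

(** * The edges between V0 and V1 *)

Section SwapCore.
Variable n : nat.
Local Notation K := (2 * swap_k n)%N.
Implicit Types (G : graph n) (e : edge n) (i j : 'I_K) (c : bool) (v : 'I_n).

(** [c] is the parity of the zero-based index: false gives [a_i], with odd label, and true gives
    [b_i]. *)
Definition pair_vertex i c : 'I_n := if c then swap_b i else swap_a i.

Lemma pair_vertexE i c : pair_vertex i c = (2 * i + c)%N :> nat.
Proof. by rewrite /pair_vertex; case: c => /=; lia. Qed.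

Lemma core_vertex_subproof j : (4 * swap_k n + j < n)%N.
Proof. by case: j => j /=; rewrite /swap_k; lia. Qed.

Definition core_vertex j : 'I_n := Ordinal (core_vertex_subproof j).

Lemma core_edge_subproof i c j :
  #|[set pair_vertex i c; core_vertex j]| == 2%N.
Proof.
rewrite cards2 eqSS eqb1; apply/negP => /eqP /(congr1 (@nat_of_ord n)).
by rewrite pair_vertexE /=; case: c; case: i => i /=; lia.
Qed.

Definition core_edge i c j : edge n :=
  exist (fun S : {set 'I_n} => #|S| == 2%N) _ (core_edge_subproof i c j).

Lemma pair_vertex_neq i c j : pair_vertex i c != core_vertex j.
Proof. by have := core_edge_subproof i c j; rewrite cards2 eqSS eqb1. Qed.

Lemma pair_vertex_inj i c i' c' : pair_vertex i c = pair_vertex i' c' -> i = i' /\ c = c'.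
Proof.
move/(congr1 (@nat_of_ord n)); rewrite !pair_vertexE => h.
by split; [apply: val_inj; rewrite /=; move: c c' h => [] []; lia | move: c c' h => [] []; lia].
Qed.

Lemma core_vertex_inj : injective core_vertex.
Proof. by move=> j j' /(congr1 (@nat_of_ord n)) /= h; apply: val_inj; rewrite /=; lia. Qed.

Definition core_edge_of (t : 'I_K * bool * 'I_K) : edge n := core_edge t.1.1 t.1.2 t.2.

Lemma core_edge_of_inj : injective core_edge_of.
Proof.
move=> [[i c] j] [[i' c'] j'] /(congr1 val) /= /setP h.
have := h (pair_vertex i c); have := h (core_vertex j).
rewrite !inE !eqxx orbT /= (negbTE (pair_vertex_neq _ _ _)) orbF.
rewrite [core_vertex j == pair_vertex _ _]eq_sym (negbTE (pair_vertex_neq _ _ _)) /=.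
by move=> /esym /eqP /core_vertex_inj -> /esym /eqP /pair_vertex_inj [-> ->].
Qed.

Definition core : {set edge n} := [set core_edge_of t | t : 'I_K * bool * 'I_K].

Lemma mem_core i c j : core_edge i c j \in core.
Proof. by apply/imsetP; exists (i, c, j). Qed.

(** One formula for two statistics: [swap_weight] gives [T_i], constant weight 1 gives [R_i]. Their
    common law is that of the lazy walk. *)
Definition row_sum (eta : 'I_K -> int) i G : int :=
  \sum_j eta j * ((core_edge i false j \in G)%:Z - (core_edge i true j \in G)%:Z).

(** With zero-based [j], odd [j] has an even label and lies in [B1] (weight 1), while even [j] lies
    in [A1] (weight -1). *)
Definition swap_weight j : int := (-1) ^+ ~~ odd j.

Lemma edges_to_core G i c (S : {set 'I_n}) (P : pred 'I_K) :
    S = [set core_vertex j | j in P] ->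
  edges_to G (pair_vertex i c) S = (\sum_(j | P j) (core_edge i c j \in G))%N.
Proof.
move=> ->; rewrite /edges_to -sum1_card.
rewrite (eq_bigl (fun u => (u \in [set core_vertex j | j in P])
    && (u \in neighbours G (pair_vertex i c)))); last first.
  by move=> u; rewrite inE andbC.
rewrite big_mkcondr big_imset /=; last by move=> j j' _ _; apply: core_vertex_inj.
apply: eq_bigr => j _; rewrite inE.
have -> : [exists e in G, val e == [set core_vertex j; pair_vertex i c]] = (core_edge i c j \in G).
  apply/existsP/idP => [[e /andP [eG /eqP ev]]|eG].
    suff <- : e = core_edge i c j by [].
    by apply: val_inj; rewrite ev setUC.
  by exists (core_edge i c j); rewrite eG /= setUC.
by case: (_ \in G).
Qed.

Lemma core_vertexP v : (4 * swap_k n <= v < 6 * swap_k n)%N -> exists j, v = core_vertex j.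
Proof.
move=> vk; have jK : (v - 4 * swap_k n < K)%N by lia.
by exists (Ordinal jK); apply: val_inj; rewrite /=; lia.
Qed.

Lemma A1E : A1 n = [set core_vertex j | j : 'I_K in [pred j : 'I_K | ~~ odd j]].
Proof.
apply/setP => v; rewrite !inE /label; apply/idP/imsetP => [h|[j jo ->]].
  have [|j vj] := @core_vertexP v; first lia.
  by exists j => //; rewrite inE; move: h; rewrite vj /=; lia.
by move: jo (ltn_ord j); rewrite inE /=; lia.
Qed.

Lemma B1E : B1 n = [set core_vertex j | j : 'I_K in [pred j : 'I_K | odd j]].
Proof.
apply/setP => v; rewrite !inE /label; apply/idP/imsetP => [h|[j jo ->]].
  have [|j vj] := @core_vertexP v; first lia.
  by exists j => //; rewrite inE; move: h; rewrite vj /=; lia.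
by move: jo (ltn_ord j); rewrite inE /=; lia.
Qed.

Lemma swap_T_row_sum G i : swap_T G i = row_sum swap_weight i G.
Proof.
rewrite /swap_T -[swap_a i]/(pair_vertex i false) -[swap_b i]/(pair_vertex i true).
rewrite !(edges_to_core _ _ _ A1E) !(edges_to_core _ _ _ B1E).
have cast (P : pred 'I_K) (F : 'I_K -> nat) :
    (\sum_(j | P j) F j)%N%:Z = \sum_(j : 'I_K) (P j)%:Z * (F j)%:Z.
  rewrite (big_morph Posz PoszD (erefl 0%:Z)) big_mkcond; apply: eq_bigr => j _.
  by case: (P j); rewrite ?mul1r ?mul0r.
rewrite !cast /row_sum -!sumrN -!big_split; apply: eq_bigr => j _ /=.
by rewrite /swap_weight; case: (odd j) => /=; lia.
Qed.

(** Defined on all naturals so that sums of signs can be computed by induction on the number of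
    vertices; both members of a pair get the same value. *)
Definition flipped G (m : nat) : bool :=
  [exists i : 'I_K, (i == m./2 :> nat) && (0 < swap_T G i)].

Definition side G v : bool := odd v (+) flipped G v.

Lemma flipped_pair G i c : flipped G (pair_vertex i c) = (0 < swap_T G i).
Proof.
apply/existsP/idP => [[i' /andP [/eqP ii]]|Ti].
  by rewrite (_ : i' = i) //; apply: val_inj; rewrite /= ii pair_vertexE; case: c ii => _ /=; lia.
by exists i; rewrite Ti andbT pair_vertexE; case: c; rewrite /=; lia.
Qed.

Lemma flipped_large G m : (4 * swap_k n <= m)%N -> flipped G m = false.
Proof.
move=> mk; apply/existsP => -[[i iK] /andP [/eqP /= im _]]; lia.
Qed.

Lemma pair_vertexP v : (v < 4 * swap_k n)%N -> exists i c, v = pair_vertex i c.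
Proof.
move=> vk; have iK : (v./2 < K)%N by lia.
by exists (Ordinal iK), (odd v); apply: val_inj; rewrite [RHS]pair_vertexE /=; lia.
Qed.

Lemma mem_A0' G i c : (pair_vertex i c \in A0' G) = ~~ (c (+) (0 < swap_T G i)).
Proof.
apply/imsetP/idP => [[i' _]|h].
  rewrite /swap_a' -[swap_a i']/(pair_vertex i' false) -[swap_b i']/(pair_vertex i' true).
  by case: ifP => T0 /pair_vertex_inj [-> ->]; rewrite T0.
exists i => //; rewrite /swap_a' /pair_vertex.
by move: h; case: c; case: (0 < swap_T G i).
Qed.

Lemma mem_B0' G i c : (pair_vertex i c \in B0' G) = c (+) (0 < swap_T G i).
Proof.
apply/imsetP/idP => [[i' _]|h].
  rewrite /swap_b' -[swap_a i']/(pair_vertex i' false) -[swap_b i']/(pair_vertex i' true).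
  by case: ifP => T0 /pair_vertex_inj [-> ->]; rewrite T0.
exists i => //; rewrite /swap_b' /pair_vertex.
by move: h; case: c; case: (0 < swap_T G i).
Qed.

Lemma swap_outputE G :
  swap_output G = [set [set v | ~~ side G v]; [set v | side G v]].
Proof.
have Aout v : (4 * swap_k n <= v)%N -> v \notin A0' G.
  move=> vk; apply/imsetP => -[i _ ev]; move: vk; rewrite ev /swap_a'.
  by case: ifP => _ /=; case: i {ev} => i /=; lia.
have Bout v : (4 * swap_k n <= v)%N -> v \notin B0' G.
  move=> vk; apply/imsetP => -[i _ ev]; move: vk; rewrite ev /swap_b'.
  by case: ifP => _ /=; case: i {ev} => i /=; lia.
congr [set _; _]; apply/setP => v; rewrite !in_setU [RHS]inE /side.
all: have [vk|vk] := ltnP v (4 * swap_k n).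
- have [i [c ev]] := pair_vertexP vk; rewrite ev mem_A0' flipped_pair -ev !inE /label.
  have -> : odd v = c by rewrite ev pair_vertexE; case: c {ev} => /=; lia.
  by case: (_ (+) _) => /=; lia.
- by rewrite flipped_large // addbF (negbTE (Aout v vk)) !inE /label /=; lia.
- have [i [c ev]] := pair_vertexP vk; rewrite ev mem_B0' flipped_pair -ev !inE /label.
  have -> : odd v = c by rewrite ev pair_vertexE; case: c {ev} => /=; lia.
  by case: (_ (+) _) => /=; lia.
- by rewrite flipped_large // addbF (negbTE (Bout v vk)) !inE /label /=; lia.
Qed.

End SwapCore.

(** * Edge sums of the output signs, split along the core edges *)

Section SwapSums.
Variables (R : realFieldType) (n : nat) (p : R).
Local Notation K := (2 * swap_k n)%N.
Implicit Types (G : graph n) (e : edge n) (i j : 'I_K) (c : bool) (v : 'I_n).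

Definition sgn G v : R := (-1) ^+ side G v.

Definition flip_sign G i : R := (-1) ^+ (0 < swap_T G i)%R.

Lemma sgn_pair G i c : sgn G (pair_vertex i c) = (-1) ^+ c * flip_sign G i.
Proof.
rewrite /flip_sign /sgn /side flipped_pair signr_addb; congr (_ ^+ _ * _); congr nat_of_bool.
by rewrite pair_vertexE; case: c => /=; lia.
Qed.

Lemma sgn_core G j : sgn G (core_vertex j) = (-1) ^+ odd j.
Proof.
rewrite /sgn /side flipped_large /= ?leq_addr // addbF; congr (_ ^+ nat_of_bool _); lia.
Qed.

Lemma normr_sgn G v : `|sgn G v| = 1.
Proof. exact: normr_sign. Qed.

Lemma sum_core (F : edge n -> R) :
  \sum_(e in core n) F e
  = \sum_i \sum_j (F (core_edge i false j) + F (core_edge i true j)).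
Proof.
rewrite big_imset /=; last by move=> t t' _ _; apply: core_edge_of_inj.
rewrite (eq_bigl xpredT) // -(pair_bigA _ (fun a j => F (core_edge_of (a, j)))) /=.
rewrite -(pair_bigA _ (fun i c => \sum_j F (core_edge_of (i, c, j)))) /=.
by apply: eq_bigr => i _; rewrite big_bool /= addrC -big_split.
Qed.

(** Core indicators are kept; each other indicator is written as [p] plus its centred part. *)
Lemma sum_core_split G (F : edge n -> R) :
  \sum_(e in G) F e = \sum_(e in core n) F e * (e \in G)%:R
    + \sum_e (if e \in core n then 0 else F e) * centred p e G
    + p * (\sum_e F e - \sum_(e in core n) F e).
Proof.
rewrite big_mkcond [X in _ = X + _ + _]big_mkcond [X in _ * (_ - X)]big_mkcond.
rewrite -sumrB mulr_sumr -!big_split; apply: eq_bigr => e _; rewrite /centred /=.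
by case: (e \in core n); case: (e \in G) => /=; ring.
Qed.

Lemma eprod_core G i c j :
  eprod (sgn G) (core_edge i c j) = (-1) ^+ c * flip_sign G i * (-1) ^+ odd j.
Proof. by rewrite (eprod2 _ (pair_vertex_neq i c j)) // sgn_pair sgn_core. Qed.

Lemma esum_core G i c j :
  esum (sgn G) (core_edge i c j) = (-1) ^+ c * flip_sign G i + (-1) ^+ odd j.
Proof. by rewrite (esum2 _ (pair_vertex_neq i c j)) // sgn_pair sgn_core. Qed.

Lemma row_sumE (eta : 'I_K -> int) i G : (row_sum eta i G)%:~R
  = \sum_j (eta j)%:~R * ((core_edge i false j \in G)%:R - (core_edge i true j \in G)%:R) :> R.
Proof.
rewrite /row_sum rmorph_sum /=; apply: eq_bigr => j _.
by rewrite intrM intrB.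
Qed.

Definition Zprod G : R :=
  \sum_e (if e \in core n then 0 else eprod (sgn G) e) * centred p e G.

Definition Zsum G : R :=
  \sum_e (if e \in core n then 0 else esum (sgn G) e) * centred p e G.

(* On a core edge only the V1 endpoint counts here: the V0 endpoint, whose sign
   depends on the graph, is accounted for by row_sum. *)
Definition core_sign v : R := if (v < 4 * swap_k n)%N then 0 else (-1) ^+ odd v.

Definition Zcore G : R :=
  \sum_e (if e \in core n then esum core_sign e else 0) * centred p e G.

Lemma sum_core_vertices_sign : \sum_(j < K) (-1) ^+ odd j = 0 :> R.
Proof.
elim: (swap_k n) => [|k IH]; first by rewrite big_ord0.
rewrite mulnS !big_ord_recr /= -[X in X + _ + _]/(\sum_(j < 2 * k) _) IH.
by rewrite oddM /= expr0 expr1; lra.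
Qed.

(** Vertices [2h] and [2h + 1] share their flip and have opposite parity, so they cancel; at most
    the last vertex is left over. *)
Lemma abs_sum_sgn G : `|\sum_v sgn G v| <= 1.
Proof.
pose f m : R := (-1) ^+ (odd m (+) flipped G m).
have f2 h : \sum_(m < h.*2) f m = 0.
  elim: h => [|h IH]; first by rewrite big_ord0.
  rewrite doubleS !big_ord_recr /= IH /f /= odd_double /= /flipped.
  rewrite (_ : h.*2.+1./2 = h.*2./2); last by lia.
  by case: [exists _, _] => /=; rewrite ?expr0 ?expr1; lra.
rewrite (eq_bigr (fun v : 'I_n => f v)) // -(odd_double_half n).
case: (odd n) => /=; rewrite ?add0n ?f2 ?normr0 //.
by rewrite add1n big_ord_recr /= f2 add0r normr_sign.
Qed.

Hypothesis p0 : 0 <= p.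

Lemma sum_eprod_ge G :
  \sum_i `|swap_T G i|%:~R + Zprod G - p * n%:R / 2 <= \sum_(e in G) eprod (sgn G) e.
Proof.
rewrite sum_core_split -/(Zprod G) !sum_core.
have -> : \sum_i \sum_j (eprod (sgn G) (core_edge i false j)
    + eprod (sgn G) (core_edge i true j)) = 0.
  rewrite big1 // => i _; rewrite big1 // => j _.
  by rewrite !eprod_core expr0 expr1; ring.
have -> : \sum_i \sum_j
    (eprod (sgn G) (core_edge i false j) * (core_edge i false j \in G)%:R
     + eprod (sgn G) (core_edge i true j) * (core_edge i true j \in G)%:R)
   = \sum_i `|swap_T G i|%:~R.
  apply: eq_bigr => i _.
  (* The swap rule at work: a pair is flipped exactly when [T_i > 0], so its core edges always
     contribute [|T_i|]. *)
  have -> : `|swap_T G i|%:~R = - flip_sign G i * (swap_T G i)%:~R :> R.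
    rewrite /flip_sign; case: (ltrP 0 (swap_T G i)) => h; first by rewrite gtr0_norm // expr1; ring.
    by rewrite ler0_norm // expr0 intrN; ring.
  rewrite swap_T_row_sum row_sumE mulr_sumr; apply: eq_bigr => j _.
  by rewrite !eprod_core /swap_weight; case: (odd j); rewrite /= ?expr0 ?expr1 ?intrN; ring.
rewrite subr0 lerD2l.
have := sum_eprod (sgn G).
have -> : \sum_v sgn G v ^+ 2 = n%:R.
  by rewrite (eq_bigr (fun=> 1)) => [|v _]; rewrite ?sqrr_sign // sumr_const card_ord.
(* Twice the full sum of sign products is a square minus [n], so the mean part costs at most
   [p n / 2]. *)
move: (\sum_e _) => S hS; have h : 0 <= p * (2 * S + n%:R).
  by rewrite mulr_ge0 // hS subrK sqr_ge0.
lra.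
Qed.

Lemma abs_sum_esum_le G :
  `|\sum_(e in G) esum (sgn G) e|
  <= \sum_i `|row_sum (fun=> 1) i G|%:~R + `|Zsum G| + `|Zcore G| + p * n%:R.
Proof.
rewrite sum_core_split -/(Zsum G) !sum_core.
have -> : \sum_i \sum_j (esum (sgn G) (core_edge i false j)
    + esum (sgn G) (core_edge i true j)) = 0.
  rewrite big1 // => i _.
  rewrite (eq_bigr (fun j : 'I_K => 2 * (-1) ^+ odd j)) => [|j _].
    by rewrite -mulr_sumr sum_core_vertices_sign mulr0.
  by rewrite !esum_core expr0 expr1; ring.
have -> : \sum_i \sum_j
    (esum (sgn G) (core_edge i false j) * (core_edge i false j \in G)%:R
     + esum (sgn G) (core_edge i true j) * (core_edge i true j \in G)%:R)
   = \sum_i flip_sign G i * (row_sum (fun=> 1) i G)%:~R + Zcore G.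
  rewrite /Zcore (eq_bigr (fun e => if e \in core n
      then esum core_sign e * centred p e G else 0)); last first.
    by move=> e _; case: ifP; rewrite ?mul0r.
  rewrite -big_mkcond sum_core -big_split; apply: eq_bigr => i _ /=.
  have cs c j : esum core_sign (core_edge i c j) = (-1) ^+ odd j.
    rewrite (esum2 _ (pair_vertex_neq i c j)) // /core_sign pair_vertexE /= ifT; last first.
      by case: c; case: i => i /=; lia.
    by rewrite ifF ?add0r; [congr (_ ^+ nat_of_bool _)|]; lia.
  (* The [V0] endpoints yield the signed unit-weight row sum. The [V1] endpoints yield [Zcore] plus
     a mean that vanishes because the signs on [V1] balance. *)
  transitivity (\sum_j (flip_sign G i * ((core_edge i false j \in G)%:R - (core_edge i true j \in G)%:R)
     + (-1) ^+ odd j * (centred p (core_edge i false j) G + centred p (core_edge i true j) G))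
     + 2 * p * \sum_(j < K) (-1) ^+ odd j).
    rewrite mulr_sumr -big_split; apply: eq_bigr => j _ /=.
    by rewrite !esum_core /centred expr0 expr1; ring.
  rewrite sum_core_vertices_sign mulr0 addr0 big_split /= row_sumE mulr_sumr; congr (_ + _).
    by apply: eq_bigr => j _; rewrite mul1r.
  by apply: eq_bigr => j _; rewrite !cs; ring.
rewrite subr0 sum_esum.
apply: le_trans (ler_normD _ _) _; apply: lerD; last first.
  rewrite normrM ger0_norm // ler_wpM2l // normrM ger0_norm //.
  apply: le_trans (_ : n.-1%:R * 1 <= _); first by rewrite ler_wpM2l ?abs_sum_sgn.
  by rewrite mulr1 ler_nat leq_pred.
apply: le_trans (ler_normD _ _) _; rewrite addrAC lerD2r.
apply: le_trans (ler_normD _ _) _; rewrite lerD2r.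
apply: le_trans (ler_norm_sum _ _ _) _; apply: ler_sum => i _.
by rewrite normrM /flip_sign normr_sign mul1r intr_norm.
Qed.

End SwapSums.

(** * Second moments *)

Section SwapMoments.
Variables (R : rcfType) (n : nat) (p : R).
Hypothesis p01 : 0 <= p <= 1.
Local Notation K := (2 * swap_k n)%N.
Local Notation q := (p * (1 - p)).
Implicit Types (G H : graph n) (e : edge n) (i j : 'I_K) (c : bool) (v : 'I_n).

Definition row i : {set edge n} := [set core_edge_of (i, t.1, t.2) | t : bool * 'I_K].

Lemma mem_row i i' c j : (core_edge i c j \in row i') = (i == i').
Proof.
apply/imsetP/eqP => [[[c' j'] _ e]|<-]; last by exists (c, j).
by have [] := @core_edge_of_inj n (i, c, j) (i', c', j') e.
Qed.

Lemma row_sum_depends eta i : depends_on (row i) (row_sum eta i).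
Proof.
move=> G H GH; apply: eq_bigr => j _.
by rewrite !GH ?mem_row.
Qed.

Lemma iter_lazy_cst (r c : R) N x : iter N (lazy_step r) (fun=> c) x = c.
Proof. by elim: N x => [//|N IH] x; rewrite iterS /lazy_step /step !IH; field. Qed.

Section RowSum.
Variable eta : 'I_K -> int.
Hypothesis eta1 : forall j, eta j = 1 \/ eta j = -1.

Lemma Ex_row_sum i D (F : graph n -> R) (phi : int -> R) :
    depends_on D F -> (forall c j, core_edge i c j \notin D) ->
  Ex p (fun G => phi (row_sum eta i G) * F G)
  = iter K (lazy_step (2 * q)) phi 0 * Ex p F.
Proof.
move=> DF rowD.
rewrite -[X in iter X](size_enum_ord K).
rewrite -(@Ex_walk _ _ p _ (enum 'I_K) eta (core_edge i false) (core_edge i true) D) //.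
- by apply: eq_Ex => G; rewrite add0r big_enum.
- have injc c : injective (core_edge i c).
    by move=> j j' h; have [] := @core_edge_of_inj n (i, c, j) (i, c, j') h.
  rewrite cat_uniq !(map_inj_uniq (injc _)) !enum_uniq andbT /=.
  apply/hasPn => _ /mapP [j _ ->]; apply/mapP => -[j' _ h].
  by have [] := @core_edge_of_inj n (i, true, j) (i, false, j') h.
Qed.

Lemma Ex_row_sum1 i (phi : int -> R) :
  Ex p (fun G => phi (row_sum eta i G)) = iter K (lazy_step (2 * q)) phi 0.
Proof.
have := @Ex_row_sum i set0 (fun=> 1) phi; rewrite Ex_cst mulr1 => <- //.
  by apply: eq_Ex => G; rewrite mulr1.
by move=> c j; rewrite inE.
Qed.

Local Notation theta := (mean_abs_lazy (2 * q) K).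
Let dev i G : R := `|row_sum eta i G|%:~R - theta.

Lemma Ex_dev_sqr i : Ex p (fun G => dev i G ^+ 2) = K%:R * (2 * q) - theta ^+ 2.
Proof.
rewrite (eq_Ex _ (F2 := fun G => (row_sum eta i G)%:~R ^+ 2
    + (- 2 * theta * absR R (row_sum eta i G) + theta ^+ 2))); last first.
  move=> G; rewrite /dev /absR.
  have -> : (row_sum eta i G)%:~R ^+ 2 = `|row_sum eta i G|%:~R ^+ 2 :> R.
    by rewrite intr_norm real_normK ?num_real.
  ring.
rewrite ExD (Ex_row_sum1 _ (fun y => y%:~R ^+ 2)) iter_lazy_sqr.
rewrite ExD ExZ Ex_row_sum1 -/(mean_abs_lazy _ _) Ex_cst mulr0z; ring.
Qed.

(** Jensen's inequality, read off from the nonnegativity of a variance. *)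
Lemma mean_abs_lazy_le_sqrt i : theta <= Num.sqrt (K%:R * (2 * q)).
Proof.
have : 0 <= Ex p (fun G => dev i G ^+ 2).
  by rewrite -(Ex_cst n p 0); apply: le_Ex => // G; rewrite sqr_ge0.
rewrite Ex_dev_sqr subr_ge0 => h; apply: le_trans (ler_norm _) _.
by rewrite -sqrtr_sqr ler_wsqrtr.
Qed.

Lemma Ex_sum_abs_row_sum :
  Ex p (fun G => (\sum_i `|row_sum eta i G|%:~R - K%:R * theta) ^+ 2)
    <= K%:R * (K%:R * (2 * q)).
Proof.
rewrite (eq_Ex _ (F2 := fun G => (\sum_i dev i G) ^+ 2)); last first.
  by move=> G; rewrite /dev sumrB sumr_const card_ord mulr_natl.
rewrite -[X in X%:R * _]card_ord; apply: Ex_sqr_sum => // [i|i j ij].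
  by rewrite Ex_dev_sqr gerBl sqr_ge0.
pose phi y := 1 * absR R y + - theta * (fun=> 1) y.
rewrite (eq_Ex _ (F2 := fun G => phi (row_sum eta i G) * dev j G)); last first.
  by move=> G; rewrite /phi /dev /absR; ring.
(* Distinct rows use disjoint edges, so the expectation factors and the factor of row [i] is
   centred. *)
rewrite (@Ex_row_sum i (row j)).
- by rewrite iter_lazy_lin iter_lazy_cst mul1r mulr1 subrr mul0r.
- by move=> G H GH; rewrite /dev (row_sum_depends _ GH).
- by move=> c j'; rewrite mem_row.
Qed.

End RowSum.

Lemma swap_T_depends i : depends_on (core n) (fun G => swap_T G i).
Proof.
move=> G H GH; rewrite !swap_T_row_sum; apply: row_sum_depends => e /imsetP [[c j] _ ->].
by apply: GH; apply: mem_core.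
Qed.

(** The core edges freeze all signs, as [Ex_centred_sum] demands of the coefficients in [Zprod] and
    [Zsum]. *)
Lemma sgn_depends v : depends_on (core n) (fun G => sgn R G v).
Proof.
move=> G H GH; rewrite /sgn /side /flipped.
rewrite (eq_existsb (P2 := fun i : 'I_K => (i == v./2 :> nat) && (0 < swap_T H i))) //.
by move=> i; rewrite (swap_T_depends i GH).
Qed.

Lemma normr_esum_le (s : 'I_n -> R) e : (forall v, `|s v| <= 1) -> `|esum s e| <= 2.
Proof.
move=> s1; have [u [v [uv ev]]] := edge_set2 e; rewrite (esum2 _ uv ev).
by apply: le_trans (ler_normD _ _) _; rewrite [leRHS](_ : 2 = 1 + 1) // lerD.
Qed.

Lemma Ex_Zprod_sqr : Ex p (fun G => Zprod p G ^+ 2) <= #|{: edge n}|%:R * (1 ^+ 2 * q).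
Proof.
apply: (Ex_centred_sum p01 (D := core n)) => [e G H GH|e ec G|e G].
- by case: ifP => [//|_]; apply: eq_bigr => v _; apply: sgn_depends GH.
- by rewrite ec.
- case: ifP => _; first by rewrite normr0.
  by rewrite normr_prod big1 // => v _; rewrite normr_sgn.
Qed.

Lemma Ex_Zsum_sqr : Ex p (fun G => Zsum p G ^+ 2) <= #|{: edge n}|%:R * (2 ^+ 2 * q).
Proof.
apply: (Ex_centred_sum p01 (D := core n)) => [e G H GH|e ec G|e G].
- by case: ifP => [//|_]; apply: eq_bigr => v _; apply: sgn_depends GH.
- by rewrite ec.
- case: ifP => _; first by rewrite normr0.
  by apply: normr_esum_le => v; rewrite normr_sgn.
Qed.

Lemma Ex_Zcore_sqr : Ex p (fun G => Zcore p G ^+ 2) <= #|{: edge n}|%:R * (2 ^+ 2 * q).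
Proof.
apply: (Ex_centred_sum p01 (D := set0)) => [e G H GH|e|e G] //; first by rewrite inE.
case: ifP => _; last by rewrite normr0.
by apply: normr_esum_le => v; rewrite /core_sign; case: ifP; rewrite ?normr0 ?normr_sign.
Qed.

Lemma Ex_edges_sqr :
  Ex p (fun G => (#|G|%:R - p * #|{: edge n}|%:R) ^+ 2) <= #|{: edge n}|%:R * (1 ^+ 2 * q).
Proof.
rewrite (eq_Ex _ (F2 := fun G => (\sum_e 1 * centred p e G) ^+ 2)).
  apply: (Ex_centred_sum p01 (D := set0)) => [e G H GH|e|e G] //; first by rewrite inE.
  by rewrite normr1.
move=> G; congr (_ ^+ 2); rewrite -sum1_card natr_sum big_mkcond /=.
rewrite mulr_natr -sumr_const -sumrB; apply: eq_bigr => e _.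
by rewrite mul1r /centred; case: (e \in G).
Qed.

End SwapMoments.

(** * Concentration *)

Section SwapProbability.

Lemma swap_k_le n : (3 * (2 * swap_k n) <= n)%N.
Proof. rewrite /swap_k; lia. Qed.

Lemma swap_k_ge n : (n <= 3 * (2 * swap_k n) + 5)%N.
Proof. rewrite /swap_k; lia. Qed.

Lemma swap_k_gt0 n : (6 <= n)%N -> (0 < 2 * swap_k n)%N.
Proof. rewrite /swap_k; lia. Qed.

Variable R : rcfType.

(** The deterministic core of the estimate, with [P = n^2 p] close to [2 m]. The coefficient of
    [x^2] comes from [0.275^2 / (8 * 0.499^2) < 0.038]. *)
Lemma score_bound (P x c m S D : R) : 0 < P -> 0 <= x -> 1 / 10 <= c <= 8 / 10 ->
    `|m - P / 2| <= 2 / 10 ^+ 4 * P ->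
    (271 / 1000 * c - 5 / 10 ^+ 4) * (P * x) <= S ->
    `|D| <= 275 / 1000 * (P * x) ->
  (271 / 1000 * c - 1 / 1000) * x - 38 / 1000 * x ^+ 2
    <= S / (2 * m) - D ^+ 2 / (8 * m ^+ 2).
Proof.
move=> P0 x0 c01 /ler_normlP [mlo mhi] hS hD.
have m0 : 0 < m by lra.
have hD2 : D ^+ 2 <= (275 / 1000 * (P * x)) ^+ 2.
  by rewrite -[D ^+ 2]real_normK ?num_real // lerXn2r // ?nnegrE // (le_trans (normr_ge0 D)).
have Px0 : 0 <= P * x by rewrite mulr_ge0 // ltW.
apply: lerB.
  rewrite ler_pdivlMr; last by lra.
  apply: le_trans hS.
  have [h0|h0] := ltrP (271 / 1000 * c - 1 / 1000) 0; first by nra.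
  have h : (271 / 1000 * c - 1 / 1000) * (2 * m) <= (271 / 1000 * c - 5 / 10 ^+ 4) * P by nra.
  by have := ler_wpM2r x0 h; lra.
rewrite ler_pdivrMr; last by rewrite mulr_gt0 // exprn_gt0.
apply: le_trans hD2 _.
have hm : (499 / 1000 * P) ^+ 2 <= m ^+ 2 by rewrite lerXn2r // ?nnegrE; lra.
have := ler_wpM2r (sqr_ge0 x) hm; have := sqr_ge0 (P * x).
rewrite !exprMn => h1 h2; lra.
Qed.

Variables (n : nat) (p c : R).
Hypotheses (n_large : (10 ^ 6 <= n)%N) (p01 : 0 <= p <= 1).
Hypotheses (np_ge : 1 <= n%:R * p) (nq_ge : n%:R * p <= n%:R - 10 ^+ 8).
Local Notation K := (2 * swap_k n)%N.
Local Notation q := (p * (1 - p)).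
Local Notation theta := (mean_abs_lazy (2 * q) K).
Hypotheses (c_range : 1 / 10 <= c <= 8 / 10).
Hypothesis theta_ge : c * Num.sqrt (K%:R * (2 * q)) <= theta.

Let x := Num.sqrt ((1 - p) / (n%:R * p)).
Let P := n%:R ^+ 2 * p.

Let N0 : 10 ^+ 6 <= n%:R :> R.
Proof. by rewrite -natrX ler_nat. Qed.

Let n_gt0 : 0 < n%:R :> R.
Proof. by rewrite ltr0n; apply: leq_trans n_large. Qed.

Let p_gt0 : 0 < p.
Proof. by rewrite -(pmulr_rgt0 _ n_gt0); apply: lt_le_trans np_ge. Qed.

Let q_gt0 : 0 < 1 - p.
Proof.
rewrite -(pmulr_rgt0 _ n_gt0) mulrBr mulr1.
by have := nq_ge; lra.
Qed.

Let P_gt0 : 0 < P.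
Proof. by rewrite mulr_gt0 // exprn_gt0. Qed.

Let x_gt0 : 0 < x.
Proof. by rewrite sqrtr_gt0 divr_gt0 // mulr_gt0. Qed.

Let Px_sqr : (P * x) ^+ 2 = n%:R ^+ 3 * q.
Proof.
have n0 : n%:R != 0 :> R by rewrite gt_eqF.
rewrite exprMn sqr_sqrtr; first by rewrite /P; field; rewrite n0 gt_eqF.
by rewrite divr_ge0 ?(ltW q_gt0) // mulr_ge0 // ltW.
Qed.

Let Px_ge0 : 0 <= P * x.
Proof. by rewrite mulr_ge0 // ltW. Qed.

Let pq_ge0 : 0 <= q.
Proof. by rewrite mulr_ge0 // ltW. Qed.

Let card_edge_le : #|{: edge n}|%:R <= n%:R ^+ 2 / 2 :> R.
Proof.
have := card_edge n R; have : n.-1%:R <= n%:R :> R by rewrite ler_nat leq_pred.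
by have := N0; nra.
Qed.

Let K_le : 3 * K%:R <= n%:R :> R.
Proof. by rewrite -natrM ler_nat swap_k_le. Qed.

Let K_ge : n%:R - 5 <= 3 * K%:R :> R.
Proof. by rewrite lerBlDr -natrM -natrD ler_nat swap_k_ge. Qed.

(** [K] is close to [n / 3], so [K sqrt (2 K q)] is close to [sqrt (2/27) P x = 0.2722 P x]. The
    constants 0.271 here and 0.273 in [theta_K] bracket this value. *)
Let K_theta : 271 / 1000 * c * (P * x) <= K%:R * theta.
Proof.
have K0 : 0 <= K%:R :> R by [].
apply: le_trans (_ : K%:R * (c * Num.sqrt (K%:R * (2 * q))) <= _); last exact: ler_wpM2l.
rewrite mulrAC [leRHS](_ : _ = (K%:R * Num.sqrt (K%:R * (2 * q))) * c); last by ring.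
apply: ler_wpM2r; first by move: c_range; lra.
rewrite -(@ler_pXn2r _ 2) // ?nnegrE; last 2 first.
- by have := Px_ge0; lra.
- by rewrite mulr_ge0 ?sqrtr_ge0.
rewrite [leLHS]exprMn Px_sqr [leRHS]exprMn sqr_sqrtr; last by rewrite mulr_ge0 // mulr_ge0.
rewrite [leRHS](_ : _ = 2 * K%:R ^+ 3 * q); last by ring.
rewrite [leLHS]mulrA; apply: ler_wpM2r; first exact: pq_ge0.
apply: le_trans (_ : 2 * (333 / 1000 * n%:R) ^+ 3 <= _).
  by have := exprn_ge0 3 (ltW n_gt0); lra.
rewrite ler_wpM2l // lerXn2r // ?nnegrE //.
  by rewrite mulr_ge0 //; lra.
by have := N0; have := K_ge; lra.
Qed.

Let theta_K : K%:R * theta <= 273 / 1000 * (P * x).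
Proof.
have K0 : 0 <= K%:R :> R by [].
have Kpos : (0 < K)%N by apply: swap_k_gt0; apply: leq_trans n_large.
have e1 (j : 'I_K) : (1 : int) = 1 \/ (1 : int) = -1 by left.
apply: le_trans (ler_wpM2l K0 (mean_abs_lazy_le_sqrt p01 e1 (Ordinal Kpos))) _.
rewrite -(@ler_pXn2r _ 2) // ?nnegrE; last 2 first.
- by rewrite mulr_ge0 ?sqrtr_ge0.
- by have := Px_ge0; lra.
rewrite [leRHS]exprMn Px_sqr [leLHS]exprMn sqr_sqrtr; last by rewrite mulr_ge0 // mulr_ge0.
rewrite [leLHS](_ : _ = 2 * K%:R ^+ 3 * q); last by ring.
rewrite [leRHS]mulrA; apply: ler_wpM2r; first exact: pq_ge0.
apply: le_trans (_ : 2 * (1 / 3 * n%:R) ^+ 3 <= _).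
  rewrite ler_wpM2l // lerXn2r // ?nnegrE //; last by have := K_le; lra.
  by rewrite mulr_ge0 //; lra.
by have := exprn_ge0 3 (ltW n_gt0); lra.
Qed.

(** This fixes the size of the constant: [n (1 - p) >= 10^8] gives
    [(P x)^2 >= 10^8 n^2 p >= 10^8 (p n)^2]. *)
Let pn_le : p * n%:R <= 1 / 10 ^+ 4 * (P * x).
Proof.
rewrite -(@ler_pXn2r _ 2) // ?nnegrE; last 2 first.
- by rewrite mulr_ge0 // ltW.
- by have := Px_ge0; lra.
rewrite [leRHS]exprMn Px_sqr.
have : 10 ^+ 8 <= n%:R * (1 - p) by have := nq_ge; lra.
have n2p : 0 <= n%:R ^+ 2 * p := ltW P_gt0.
move=> /(ler_wpM2l n2p) h.
have : (p * n%:R) ^+ 2 <= n%:R ^+ 2 * p.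
  have p1 : p <= 1 by case/andP: p01.
  by have := ler_wpM2l n2p p1; lra.
lra.
Qed.

(** Six applications of Chebyshev's inequality, each failing with probability at most
    [2 * 10^8 / n]. *)
Lemma swap_score_prob :
  1 - 12 * 10 ^+ 8 / n%:R <= gnp_prob p (fun G : graph n =>
    (271 / 1000 * c - 1 / 1000) * x - 38 / 1000 * x ^+ 2
      <= modularity_score G R (swap_output G)).
Proof.
pose Y (i : 'I_6) (G : graph n) : R := match val i with
  | 0 => \sum_i `|row_sum (@swap_weight n) i G|%:~R - K%:R * theta
  | 1 => \sum_i `|row_sum (fun=> 1) i G|%:~R - K%:R * theta
  | 2 => Zprod p G
  | 3 => Zsum p G
  | 4 => Zcore p G
  | _ => #|G|%:R - p * #|{: edge n}|%:R
  end.
pose t (i : 'I_6) : R := 1 / 10 ^+ 4 * (if (i < 5)%N then P * x else P).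
have -> : 12 * 10 ^+ 8 / n%:R = \sum_(i < 6) (2 * 10 ^+ 8 / n%:R) :> R.
  by rewrite sumr_const card_ord -mulr_natl; ring.
apply: (chebyshev_union p01 (Y := Y) (t := t)) => //.
- by move=> i; rewrite /t mulr_gt0 //; [lra | case: ifP => _ //; rewrite mulr_gt0].
(* The first five second moments are at most [2 n^2 q], while the squared tolerance is
   [10^-8 n^3 q]. *)
- have tQ : 2 * 10 ^+ 8 / n%:R * (1 / 10 ^+ 4 * (P * x)) ^+ 2 = 2 * n%:R ^+ 2 * q.
    by rewrite exprMn Px_sqr; field; rewrite gt_eqF.
  have KK : K%:R * (K%:R * (2 * q)) <= 2 * n%:R ^+ 2 * q.
    rewrite [leLHS](_ : _ = 2 * K%:R ^+ 2 * q); last by ring.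
    rewrite ler_wpM2r // ler_wpM2l // lerXn2r ?nnegrE //.
    by have := K_le; have : 0 <= K%:R :> R by []; lra.
  have EE (b : R) : 0 <= b <= 2 -> #|{: edge n}|%:R * (b ^+ 2 * q) <= 2 * n%:R ^+ 2 * q.
    case/andP=> b0 b2; rewrite mulrA ler_wpM2r //.
    rewrite [leRHS](_ : _ = n%:R ^+ 2 / 2 * 2 ^+ 2); last by field.
    apply: ler_pM => //; first by rewrite exprn_ge0.
    by rewrite lerXn2r // nnegrE.
  case=> [[|[|[|[|[|[|//]]]]]] lt6]; rewrite /Y /t /= ?tQ.
  + apply: le_trans KK; apply: Ex_sum_abs_row_sum => // j.
    by rewrite /swap_weight; case: (odd j); [left | right].
  + by apply: le_trans KK; apply: Ex_sum_abs_row_sum => // j; left.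
  + by apply: le_trans (EE 1 _); [apply: Ex_Zprod_sqr | lra].
  + by apply: le_trans (EE 2 _); [apply: Ex_Zsum_sqr | lra].
  + by apply: le_trans (EE 2 _); [apply: Ex_Zcore_sqr | lra].
  + apply: le_trans (Ex_edges_sqr n p01) _; rewrite expr1n mul1r.
    (* The edge count has tolerance [10^-4 P]; here [np >= 1] makes the ratio small enough. *)
    rewrite [leRHS](_ : _ = 2 * n%:R ^+ 2 * p * (n%:R * p)); last first.
      by rewrite /P; field; rewrite gt_eqF.
    have h1 : 0 <= n%:R ^+ 2 * p := ltW P_gt0.
    have := ler_wpM2r pq_ge0 card_edge_le; have := ler_wpM2l h1 np_ge.
    have : n%:R ^+ 2 * q <= n%:R ^+ 2 * p by have := ler_wpM2l h1 (ltW p_gt0); lra.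
    lra.
- move=> G bad.
  have := bad (@Ordinal 6 0 isT); have := bad (@Ordinal 6 1 isT).
  have := bad (@Ordinal 6 2 isT); have := bad (@Ordinal 6 3 isT).
  have := bad (@Ordinal 6 4 isT); have := bad (@Ordinal 6 5 isT).
  rewrite /Y /t /= => b5 b4 b3 b2 b1 b0.
  have E2 : 2 * (p * #|{: edge n}|%:R) = P - p * n%:R.
    have := card_edge n R; rewrite -subn1 natrB; last exact: leq_trans n_large.
    by rewrite /P => h; rewrite mulrCA h; ring.
  have pn0 : 0 <= p * n%:R by rewrite mulr_ge0 // ltW.
  have pnP : p * n%:R <= P / 10 ^+ 6.
    rewrite ler_pdivlMr; last by rewrite exprn_gt0.
    have : 0 <= p * n%:R * (n%:R - 10 ^+ 6) by rewrite mulr_ge0 // subr_ge0 N0.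
    by rewrite /P; lra.
  have P0 := P_gt0; have Q0 := mulr_gt0 P_gt0 x_gt0; have ? := N0.
  have hm : `|#|G|%:R - P / 2| <= 2 / 10 ^+ 4 * P.
    by move/ler_normlP: b5 => [b5l b5r]; apply/ler_normlP; split; lra.
  have G0 : G != set0.
    apply: contraTneq hm => ->; rewrite cards0 -ltNge sub0r normrN ger0_norm; lra.
  rewrite swap_outputE modularity_two //; last exact: leq_trans n_large.
  apply: (score_bound P_gt0 (ltW x_gt0) c_range hm).
    have := sum_eprod_ge (ltW p_gt0) G.
    rewrite (eq_bigr (fun i => `|row_sum (@swap_weight n) i G|%:~R)); last first.
      by move=> i _; rewrite swap_T_row_sum.
    move/ler_normlP: b0 => [b0 _]; move/ler_normlP: b2 => [b2 _].
    have := K_theta; have := pn_le; rewrite /sgn; lra.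
  have := abs_sum_esum_le (ltW p_gt0) G; rewrite /sgn.
  move/ler_normlP: b1 => [_ b1].
  have := theta_K; have := pn_le; lra.
Qed.

End SwapProbability.

(** * The dense and sparse regimes *)

Section SwapRegimes.
Variables (R : rcfType) (n : nat) (p : R).
Hypotheses (n_large : (10 ^ 6 <= n)%N) (p01 : 0 <= p <= 1).
Local Notation K := (2 * swap_k n)%N.
Local Notation q := (p * (1 - p)).

Lemma gnp_prob_mono (Q1 Q2 : pred (graph n)) :
  (forall G, Q1 G -> Q2 G) -> gnp_prob p Q1 <= gnp_prob p Q2.
Proof.
move=> Q12; rewrite !gnp_prob_Ex; apply: le_Ex => // G; rewrite ler_nat.
by case: (Q1 G) (Q12 G) => // ->.
Qed.

Lemma row_variance_ge (M : R) : 0 <= M -> M <= n%:R * p -> M <= n%:R - n%:R * p ->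
  3 / 10 * M <= K%:R * (2 * q).
Proof.
case/andP: p01 => p0 p1 M0 Mp Mq.
have N0 : 10 ^+ 6 <= n%:R :> R by rewrite -natrX ler_nat.
have n0 : 0 <= n%:R :> R by [].
have K_ge : 332 / 1000 * n%:R <= K%:R :> R.
  have : n%:R <= 3 * K%:R + 5 :> R by rewrite -natrM -natrD ler_nat swap_k_ge.
  lra.
have q0 : 0 <= q by rewrite mulr_ge0 // subr_ge0.
(* One of [p] and [1 - p] is at least 1/2, and [n] times the other is at least [M]. *)
have nq : M / 2 <= n%:R * q.
  have [h|h] := lerP p (1 / 2).
    have : 0 <= n%:R * p * (1 - p - 1 / 2) by rewrite !mulr_ge0 //; lra.
    lra.
  have : 0 <= (n%:R - n%:R * p) * (p - 1 / 2) by rewrite mulr_ge0 //; lra.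
  lra.
have := ler_wpM2r q0 K_ge; lra.
Qed.

Lemma double_q_range : 0 <= 2 * q <= 1.
Proof.
case/andP: p01 => p0 p1; have := sqr_ge0 (2 * p - 1); have : 0 <= q by rewrite mulr_ge0 // subr_ge0.
by move=> *; apply/andP; split; lra.
Qed.

Lemma swap_prob_dense : 10 ^+ 8 <= n%:R * p <= n%:R - 10 ^+ 8 ->
  1 - 12 * 10 ^+ 8 / n%:R <= gnp_prob p (fun G : graph n =>
    5^-1 * Num.sqrt ((1 - p) / (n%:R * p)) <= modularity_score G R (swap_output G)).
Proof.
case/andP=> np nq; set x := Num.sqrt _.
have c01 : 1 / 10 <= (76 / 100 : R) <= 8 / 10 by lra.
have var_ge : 1000 ^+ 2 <= K%:R * (2 * q).
  by have := @row_variance_ge (10 ^+ 8) (exprn_ge0 _ (ler0n _ _)) np; lra.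
have np1 : 1 <= n%:R * p by lra.
apply: le_trans (swap_score_prob n_large p01 np1 nq c01
  (mean_abs_lazy_ge_large double_q_range var_ge)) _.
apply: gnp_prob_mono => G; apply: le_trans.
have x0 : 0 <= x by rewrite sqrtr_ge0.
(* Then the coefficient of [x] is at least [0.271 * 0.76 - 0.001 - 0.0038 > 1/5]. *)
have x_le : x <= 1 / 10.
  rewrite -(@ler_pXn2r _ 2) // ?nnegrE //; last by lra.
  rewrite sqr_sqrtr; last by rewrite divr_ge0 //; move: p01; lra.
  by rewrite ler_pdivrMr; move: p01; lra.
have := mulr_ge0 x0 (_ : 0 <= 1 / 10 - x); rewrite subr_ge0 => /(_ x_le).
by rewrite -/x; lra.
Qed.

Lemma swap_prob_sparse : 1 <= n%:R * p <= n%:R - 10 ^+ 8 ->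
  1 - 12 * 10 ^+ 8 / n%:R <= gnp_prob p (fun G : graph n =>
    1 / 100 * Num.sqrt ((1 - p) / (n%:R * p)) <= modularity_score G R (swap_output G)).
Proof.
case/andP=> np nq; set x := Num.sqrt _.
have c01 : 1 / 10 <= (2 / 10 : R) <= 8 / 10 by lra.
have var_ge : 1 / 4 <= K%:R * (2 * q).
  by have := @row_variance_ge 1 ler01 np; lra.
apply: le_trans (swap_score_prob n_large p01 np nq c01
  (mean_abs_lazy_ge_small double_q_range var_ge)) _.
apply: gnp_prob_mono => G; apply: le_trans.
have x0 : 0 <= x by rewrite sqrtr_ge0.
(* Then the coefficient of [x] is at least [0.271 * 0.2 - 0.001 - 0.038 = 0.0152]. *)
have x_le : x <= 1.
  rewrite -(@ler_pXn2r _ 2) // ?nnegrE //.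
  rewrite sqr_sqrtr; last by rewrite divr_ge0 //; move: p01; lra.
  by rewrite ler_pdivrMr; move: p01; lra.
have := mulr_ge0 x0 (_ : 0 <= 1 - x); rewrite subr_ge0 => /(_ x_le).
by rewrite -/x; lra.
Qed.

End SwapRegimes.

(* Passage to the limit *)
From mathcomp Require Import all_classical all_reals all_analysis.
Import numFieldNormedType.Exports.
Local Open Scope classical_set_scope.

Lemma cvg_to_one (R : realType) (u : nat -> R) (C : R) :
  (forall n, u n <= 1) -> (\forall n \near \oo, 1 - C / n%:R <= u n) -> u @ \oo --> (1 : R).
Proof.
move=> u1 uC; apply/cvgrPdist_le => e e0; near=> n.
have n0 : 0 < n%:R :> R by rewrite ltr0n; near: n; exists 1%N.
rewrite ger0_norm ?subr_ge0 //.
have h : 1 - C / n%:R <= u n by near: n.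
have : C / n%:R <= e.
  rewrite ler_pdivrMr // mulrC -ler_pdivrMr //.
  by near: n; apply: nbhs_infty_ger.
move: h; lra.
Unshelve. all: by end_near.
Qed.

Theorem theorem4p1 (R : realType) :
  exists c0 a : R, [/\ 0 < c0, 0 < a,
    (forall p : nat -> R,
       (forall n : nat, 0 <= p n <= 1) ->
       (\forall n \near \oo, c0 <= n%:R * p n <= n%:R - c0) ->
       (fun n : nat => gnp_prob (p n) (fun G : graph n =>
          5^-1 * Num.sqrt ((1 - p n) / (n%:R * p n))
            <= modularity_score G R (swap_output G))) @ \oo --> (1 : R))
  & (forall p : nat -> R,
       (forall n : nat, 0 <= p n <= 1) ->
       (\forall n \near \oo, 1 <= n%:R * p n <= n%:R - c0) ->
       (fun n : nat => gnp_prob (p n) (fun G : graph n =>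
          a * Num.sqrt ((1 - p n) / (n%:R * p n))
            <= modularity_score G R (swap_output G))) @ \oo --> (1 : R))].
Proof.
(* [10^8] is the square of the inverse tolerance [10^4], and [1/100] lies below the sparse
   coefficient 0.0152. *)
exists (10 ^+ 8), (1 / 100); split; [by rewrite exprn_gt0 | lra | |].
- move=> p p01 hp; apply: (@cvg_to_one _ _ (12 * 10 ^+ 8)) => [n|].
    exact: gnp_prob_le1.
  near=> n; apply: swap_prob_dense => //; first by near: n; exists (10 ^ 6)%N.
  by near: n.
- move=> p p01 hp; apply: (@cvg_to_one _ _ (12 * 10 ^+ 8)) => [n|].
    exact: gnp_prob_le1.
  near=> n; apply: swap_prob_sparse => //; first by near: n; exists (10 ^ 6)%N.
  by near: n.
Unshelve. all: by end_near.
Qed.
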